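(* $L'$ is a perfect set, i.e., $L''=L'$.
   Context: For irrational $\alpha$, $k(\alpha):=\sup\{k>0 \mid |\alpha-\frac pq|<\frac{1}{kq^2} \text{ has infinitely many rational solutions } \frac pq\}\in(0,+\infty]$. The Lagrange spectrum is $L=\{k(\alpha)\mid \alpha\in\mathbb{R}\setminus\mathbb{Q},\ k(\alpha)<+\infty\}\subset\mathbb R$. For $A\subset\mathbb R$, $A'$ denotes the set of accumulation points of $A$ in $\mathbb R$, and $A''=(A')'$. *)

(* Defs.v *)
(* MathComp-Analysis *)
From HB Require Import structures.
From mathcomp Require Import all_boot all_order all_algebra.
From mathcomp Require Import all_classical all_reals all_analysis.
Set Implicit Arguments.
Unset Strict Implicit.
Unset Printing Implicit Defensive.
Import Order.TTheory GRing.Theory Num.Theory.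
Import numFieldNormedType.Exports.
Local Open Scope classical_set_scope.
Local Open Scope ring_scope.

(* Solutions are counted as rational numbers, and the denominator q of p/q is
   the reduced one. Allowing non-reduced p/q would give the same set, since
   reducing a fraction only weakens the inequality. *)
Definition approx_solutions (R : realType) (alpha k : R) : set rat :=
  [set r : rat | `|alpha - ratr r| < 1 / (k * (denq r)%:~R ^+ 2)].

(* The supremum is taken in \bar R, so it is +oo when the set of admissible k
   is unbounded. *)
Definition lagrange_value (R : realType) (alpha : R) : \bar R :=
  ereal_sup [set k%:E | k in
    [set k : R | 0 < k /\ infinite_set (approx_solutions alpha k)]].

(* Equality with a finite x%:E encodes the condition k(alpha) < +oo; the value
   -oo does not occur, because every irrational alpha admits k = 1. *)
Definition lagrange_spectrum (R : realType) : set R :=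
  [set x : R | exists2 alpha : R, irrational alpha &
                                  lagrange_value alpha = x%:E].
Arguments lagrange_spectrum : clear implicits.

(* Main.v *)
Require Import Defs.
From mathcomp Require Import all_boot all_order all_algebra.
From mathcomp Require Import all_classical all_reals all_analysis.
From mathcomp Require Import ring lra zify.
Import numFieldNormedType.Exports.

(** By Perron's formula, the spectrum [L] is the set of the finite upper limits
    of [lambda d n = [d_n; d_(n+1), ...] + [0; d_(n-1), ..., d_0]], for [d] a
    sequence of positive digits ([lagrange_spectrumP]). Derived sets are closed,
    so the point is to find, near each [x] in [L'], a point of [L'] other than
    [x] ([lagrange_spectrum_nearby]).

    Up to [e], the upper limit of [lambda d] depends only on the set of the words
    of some length [K] that occur infinitely often in [d] ([limsup_shadowed]).
    The points of [L] near [x] have bounded digits, hence two distinct ones have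
    digit sequences [d1] and [d2] with the same recurrent words. Consider the
    loops of [d1] and [d2], that is, the words between two occurrences of a fixed
    recurrent word. If they all commuted with a given loop, then [d1] and [d2]
    would be eventually periodic with a common tail, and would give the same
    point. Two loops that do not commute yield two distinct words of the same
    even length, all the infinite concatenations of which have the same
    recurrent words as [d1], thus upper limits near [x] ([loop_block_code]).

    It remains to see that the upper limits of such block sequences form an
    uncountable set ([uncountable_block_limsups]): an uncountable set of points
    of [L] near [x] has a limit point near [x] and other than [x]. Since the
    blocks have even length, they act on tails by increasing maps, and the largest
    Perron value of bi-infinite block sequences is attained at some block [c] with
    a constant future and a constant past; a block whose neighbours on one side
    change early stays below it by a fixed gap ([bilambda_max]). Insert rarely long markers, made of such a [c] with long
    constant runs on both sides, in a sequence of blocks that otherwise changes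
    all the time and encodes a set [P] of natural numbers to the right of each
    marker. The upper limit is then attained at one of finitely many positions
    in the limiting marker ([marked_limsup]), and at a given position the value
    determines [P]. So countably many upper limits would leave only countably many
    sets [P]. *)

Set Implicit Arguments.
Unset Strict Implicit.
Unset Printing Implicit Defensive.
Import Order.TTheory GRing.Theory Num.Theory.
Local Open Scope classical_set_scope.
Local Open Scope ring_scope.

(** * Continued fractions *)

(** The sequence with its first [k] terms removed. *)
Definition seq_shift (T : Type) (k : nat) (d : nat -> T) : nat -> T :=
  fun i => d (k + i)%N.

(** The word of length [k] that starts at position [n] of [d]. *)
Definition factor (T : Type) (d : nat -> T) (n k : nat) : seq T :=
  mkseq (seq_shift n d) k.

Local Notation positive d := (forall n, (0 < d n)%N).
Local Notation all_pos w := (all (leq 1) w).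

Section ContinuedFractions.
Variable R : realType.
Implicit Types (w : seq nat) (x y : R) (d : nat -> nat).

(** The continued fraction [[0; w_0, ..., w_(n-1) + x]], as a function of its
    tail [x]. *)
Definition mobius w x : R := foldr (fun a t => (a%:R + t)^-1) x w.

(** The value [[0; d_0, d_1, ...]] of an infinite continued fraction. It is
    meaningful for sequences of positive digits only. *)
Definition cf d : R := lim ((fun n => mobius (factor d 0 n) 0) @ \oo).

Lemma mobius_cat w1 w2 x : mobius (w1 ++ w2) x = mobius w1 (mobius w2 x).
Proof. by rewrite /mobius foldr_cat. Qed.

Lemma ler1_digit a : (0 < a)%N -> 1 <= a%:R :> R.
Proof. by move=> a0; rewrite ler1n. Qed.

Lemma mobius_cons a w x : mobius (a :: w) x = (a%:R + mobius w x)^-1.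
Proof. by []. Qed.

Lemma mobius_itvcc w x : all_pos w -> 0 <= x <= 1 -> 0 <= mobius w x <= 1.
Proof.
move=> + x01; elim: w => // a w IH /andP[a0 /IH]; rewrite mobius_cons.
move: (mobius w x) => t /andP[t0 t1]; have := ler1_digit a0 => a1.
by rewrite invr_ge0 addr_ge0 ?ler0n //= invf_le1; lra.
Qed.

Lemma mobius_itvoo w x : all_pos w -> 0 < x < 1 -> 0 < mobius w x < 1.
Proof.
move=> + x01; elim: w => // a w IH /andP[a0 /IH]; rewrite mobius_cons.
move: (mobius w x) => t /andP[t0 t1]; have := ler1_digit a0 => a1.
by rewrite invr_gt0 invf_lt1; lra.
Qed.

Lemma mobius_lipschitz w x y : all_pos w -> 0 <= x <= 1 -> 0 <= y <= 1 ->
  `|mobius w x - mobius w y| <= `|x - y|.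
Proof.
move=> + x01 y01; elim: w => // a w IH /andP[a0 pw].
have := IH pw; have := mobius_itvcc pw x01; have := mobius_itvcc pw y01.
rewrite !mobius_cons.
move: (mobius w x) (mobius w y) => s t t01 s01 st.
have := ler1_digit a0; set A : R := a%:R => a1.
have -> : (A + s)^-1 - (A + t)^-1 = (t - s) / ((A + s) * (A + t)).
  by field; apply/andP; split; apply: lt0r_neq0; lra.
rewrite normrM normfV distrC (le_trans _ st) // ler_piMr //.
by rewrite ger0_norm ?invf_le1; nra.
Qed.

(** A pair of digits contracts by a factor at least [4], because the denominator
    [a * (b + s) + 1] is at least [2]. *)
Lemma mobius_contract n w x y : all_pos w -> (n.*2 <= size w)%N ->
  0 <= x <= 1 -> 0 <= y <= 1 ->
  `|mobius w x - mobius w y| <= 4^-1 ^+ n * `|x - y|.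
Proof.
move=> + + x01 y01; elim: n w => [|n IH] w.
  by move=> pw _; rewrite expr0 mul1r; exact: mobius_lipschitz.
case: w => [|a [|b w]] // /and3P[a0 b0 pw] nw.
have := IH w pw nw; have := mobius_itvcc pw x01; have := mobius_itvcc pw y01.
rewrite !mobius_cons.
move: (mobius w x) (mobius w y) => s t t01 s01 st.
have := ler1_digit a0; have := ler1_digit b0.
set A : R := a%:R; set B : R := b%:R => b1 a1.
have h1 : 2 <= A * (B + s) + 1 by nra.
have h2 : 2 <= A * (B + t) + 1 by nra.
have -> : (A + (B + s)^-1)^-1 - (A + (B + t)^-1)^-1 =
   (s - t) / ((A * (B + s) + 1) * (A * (B + t) + 1)).
  by field; apply/and4P; split; apply: lt0r_neq0; lra.
rewrite normrM normfV exprS -mulrA mulrC; apply: ler_pM => //.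
rewrite ger0_norm; last by nra.
by rewrite lef_pV2 ?posrE; nra.
Qed.

Lemma mobius_close n w x y : all_pos w -> (n.*2 <= size w)%N ->
  0 <= x <= 1 -> 0 <= y <= 1 -> `|mobius w x - mobius w y| <= 4^-1 ^+ n.
Proof.
move=> pw nw x01 y01; apply: (le_trans (mobius_contract pw nw x01 y01)).
by rewrite ler_piMr ?exprn_ge0 ?invr_ge0 // ler_norml; lra.
Qed.

Lemma quarter_small (e : R) : 0 < e -> exists n, 4^-1 ^+ n < e.
Proof.
move=> e0; have := @cvg_expr R 4^-1 _; rewrite ger0_norm ?invr_ge0//.
have -> : (4^-1 < 1 :> R) by lra.
move=> /(_ isT)/cvgrPdist_lt/(_ _ e0)[n _ /(_ n (leqnn n))] /=.
by rewrite sub0r normrN ger0_norm ?exprn_ge0 ?invr_ge0//; exists n.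
Qed.

Lemma factor_pos d n k : positive d -> all_pos (factor d n k).
Proof. by move=> pd; apply/allP => a /mapP[i _ ->]; exact: pd. Qed.

Lemma size_factor (T : Type) (d : nat -> T) n k : size (factor d n k) = k.
Proof. by rewrite size_mkseq. Qed.

Lemma shift_shift (T : Type) (d : nat -> T) n m :
  seq_shift n (seq_shift m d) = seq_shift (m + n) d.
Proof. by apply/funext => i; rewrite /seq_shift addnA. Qed.

Lemma factor_shift (T : Type) (d : nat -> T) m n k :
  factor (seq_shift m d) n k = factor d (m + n) k.
Proof. by rewrite /factor shift_shift. Qed.

Lemma factorD (T : Type) (d : nat -> T) n k l :
  factor d n (k + l) = factor d n k ++ factor d (n + k) l.
Proof.
rewrite /factor /mkseq iotaD map_cat; congr (_ ++ _).
by rewrite add0n -{1}[k]addn0 iotaDl -map_comp /= -shift_shift.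
Qed.

Lemma factorS (T : Type) (d : nat -> T) n k :
  factor d n k.+1 = d n :: factor d n.+1 k.
Proof. by rewrite -[k.+1]add1n factorD addn1 /factor /mkseq /= /seq_shift addn0. Qed.

Lemma trunc_close d n m : positive d -> (n.*2 <= m)%N ->
  `|mobius (factor d 0 m) 0 - mobius (factor d 0 n.*2) 0| <= 4^-1 ^+ n :> R.
Proof.
move=> pd nm; rewrite -(subnKC nm) factorD mobius_cat.
apply: mobius_close; rewrite ?size_factor ?factor_pos ?lexx ?ler01 //.
by apply: mobius_itvcc; rewrite ?factor_pos ?lexx ?ler01.
Qed.

Lemma cf_cvg d : positive d ->
  (fun n => mobius (factor d 0 n) 0) @ \oo --> cf d.
Proof.
move=> pd; suff: cvgn (fun n => mobius (factor d 0 n) 0 : R) by [].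
apply/cauchy_cvgP/cauchy_exP => e e0; have [n ne] := quarter_small e0.
exists (mobius (factor d 0 n.*2) 0); exists n.*2 => // m /= nm.
by rewrite /ball/= distrC (le_lt_trans _ ne) // trunc_close.
Qed.

Lemma cf_trunc_close d n m : positive d -> (n.*2 <= m)%N ->
  `|cf d - mobius (factor d 0 m) 0| <= 2 * 4^-1 ^+ n.
Proof.
move=> pd nm; have dc := cf_cvg pd.
have {}dc : (fun k => `|mobius (factor d 0 k) 0 - mobius (factor d 0 m) 0|)
    @ \oo --> `|cf d - mobius (factor d 0 m) 0|.
  by apply: cvg_norm; apply: cvgB => //; exact: cvg_cst.
rewrite -(cvg_lim _ dc)//; apply: limr_le; first by apply: cvgP dc.
exists n.*2 => // k /= nk.
by have := trunc_close pd nk; have := trunc_close pd nm; rewrite !ler_norml; lra.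
Qed.

Lemma cf_itvcc d : positive d -> 0 <= cf d <= 1.
Proof.
move=> pd; have dc := cf_cvg pd.
have h n : (0 : R) <= mobius (factor d 0 n) 0 <= 1.
  by apply: mobius_itvcc; rewrite ?factor_pos ?lexx ?ler01.
apply/andP; split.
  rewrite -(cvg_lim _ dc)//; apply: limr_ge; first exact: cvgP dc.
  by exists 0%N => // n _; case/andP: (h n).
rewrite -(cvg_lim _ dc)//; apply: limr_le; first exact: cvgP dc.
by exists 0%N => // n _; case/andP: (h n).
Qed.

Lemma eq_small x y : (forall n, `|x - y| <= 4 * 4^-1 ^+ n) -> x = y.
Proof.
move=> h; apply/eqP; rewrite -subr_eq0 -normr_le0; apply/ler_addgt0Pr => e e0.
have [n ne] := quarter_small (divr_gt0 e0 (ltr0n R 4)).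
by rewrite add0r (le_trans (h n)) // -ler_pdivlMl // ltW // mulrC.
Qed.

Lemma positive_shift d k : positive d -> positive (seq_shift k d).
Proof. by move=> pd n; exact: pd. Qed.

Lemma cf_rec d : positive d -> cf d = ((d 0)%:R + cf (seq_shift 1 d))^-1.
Proof.
move=> pd; have pd' := positive_shift 1 pd.
apply: eq_small => n; have h1 := @cf_trunc_close d n n.*2.+1 pd (leqnSn _).
have h2 := @cf_trunc_close (seq_shift 1 d) n n.*2 pd' (leqnn _).
have t01 : (0 : R) <= mobius (factor (seq_shift 1 d) 0 n.*2) 0 <= 1.
  by apply: mobius_itvcc; rewrite ?factor_pos ?lexx ?ler01.
have := @mobius_lipschitz [:: d 0] _ _ _ (cf_itvcc pd') t01.
rewrite /= pd => /(_ isT) /le_trans/(_ h2); move: h1.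
rewrite factorS !mobius_cons factor_shift addn0 !ler_norml; lra.
Qed.

Lemma cf_mobius d n : positive d ->
  cf d = mobius (factor d 0 n) (cf (seq_shift n d)).
Proof.
move=> pd; elim: n d pd => [//|n IH] d pd.
rewrite factorS mobius_cons cf_rec // (IH _ (positive_shift 1 pd)).
by rewrite factor_shift shift_shift addn0.
Qed.

Lemma cf_itvoo d : positive d -> 0 < cf d < 1.
Proof.
move=> pd.
have c0 e : positive e -> 0 < cf e.
  move=> pe; rewrite cf_rec // invr_gt0.
  by have := cf_itvcc (positive_shift 1 pe); have := ler1_digit (pe 0%N); lra.
rewrite c0 //= cf_rec // invf_lt1.
  by have := c0 _ (positive_shift 1 pd); have := ler1_digit (pd 0%N); lra.
by have := c0 _ (positive_shift 1 pd); have := ler1_digit (pd 0%N); lra.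
Qed.

(** Continued fractions depend uniformly continuously on their digits. *)
Lemma cf_continuous (e : R) : 0 < e -> exists n, forall d d',
  positive d -> positive d' -> (forall i, (i < n)%N -> d i = d' i) ->
  `|cf d - cf d'| < e.
Proof.
move=> /quarter_small[n ne]; exists n.*2 => d d' pd pd' dd'.
rewrite (cf_mobius n.*2 pd) (cf_mobius n.*2 pd').
have -> : factor d' 0 n.*2 = factor d 0 n.*2.
  by apply/eq_in_map => i; rewrite mem_iota /seq_shift => /andP[_ /dd'->].
apply: le_lt_trans ne; apply: mobius_close; rewrite ?size_factor ?factor_pos //.
- exact/cf_itvcc/positive_shift.
- exact/cf_itvcc/positive_shift.
Qed.

(** Any sequence in [[0, 1]] that follows the continued fraction recursion with
    digits [d] starts with [cf d]. *)
Lemma cf_digits_unique d (x : nat -> R) : positive d ->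
  (forall n, 0 <= x n <= 1 /\ x n = ((d n)%:R + x n.+1)^-1) -> x 0%N = cf d.
Proof.
move=> pd xd.
have xm n : x 0%N = mobius (factor d 0 n) (x n).
  elim: n => [//|n IH]; rewrite -addn1 factorD mobius_cat /= IH /seq_shift !addn0.
  by rewrite addn1 /mobius /= -(xd n).2.
apply: eq_small => n; rewrite (xm n.*2) (cf_mobius n.*2 pd).
apply: (@le_trans _ _ (4^-1 ^+ n)).
  apply: mobius_close; rewrite ?size_factor ?factor_pos //; first exact: (xd _).1.
  exact/cf_itvcc/positive_shift.
by rewrite ler_peMl ?exprn_ge0 ?invr_ge0 //; lra.
Qed.

Lemma cf_inj d d' : positive d -> positive d' -> cf d = cf d' -> d = d'.
Proof.
move=> pd pd' E; apply/funext => n.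
suff H m : cf (seq_shift m d) = cf (seq_shift m d') ->
    d m = d' m /\ cf (seq_shift m.+1 d) = cf (seq_shift m.+1 d').
  suff: cf (seq_shift n d) = cf (seq_shift n d') by move=> /H[].
  by elim: n => [|n /H[]].
have ps k e : positive e -> 0 < cf (seq_shift k e) < 1.
  by move=> pe; exact/cf_itvoo/positive_shift.
rewrite (cf_rec (positive_shift m pd)) (cf_rec (positive_shift m pd')).
move=> /invr_inj; rewrite !shift_shift /seq_shift addn0 addn1 => H.
have := ps m.+1 _ pd; have := ps m.+1 _ pd' => h h'.
have {}h'' : d m = d' m.
  have [lt|lt|//] := ltngtP (d m) (d' m).
    by exfalso; move: lt; rewrite -addn1 -(ler_nat R) natrD; lra.
  by exfalso; move: lt; rewrite -addn1 -(ler_nat R) natrD; lra.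
by split=> //; move: H; rewrite h''; exact: addrI.
Qed.

End ContinuedFractions.

(** * Perron values and their upper limits *)

Section LimsupOfLambda.
Variable R : realType.
Implicit Types (d : nat -> nat) (u : nat -> R) (v : R).

(** The finite continued fraction [[0; d_(n-1), ..., d_0]]. *)
Definition past d n : R := mobius (rev (factor d 0 n)) 0.

(** The Perron value
    [[d_n; d_(n+1), ...] + [0; d_(n-1), ..., d_0]]. *)
Definition lambda d n : R := (cf R (seq_shift n d))^-1 + past d n.

(** [v] is the (finite) upper limit of [u]. *)
Definition is_limsup u v :=
  (forall e, 0 < e -> exists N, forall n, (N <= n)%N -> u n < v + e) /\
  (forall e, 0 < e -> forall N, exists2 n, (N <= n)%N & v - e < u n).

Lemma past_rec d n : past d n.+1 = ((d n)%:R + past d n)^-1.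
Proof. by rewrite /past -addn1 factorD rev_cat /= /seq_shift addn0. Qed.

Lemma pastD d n m :
  past d (n + m) = mobius (rev (factor d n m)) (past d n).
Proof. by rewrite /past factorD rev_cat mobius_cat. Qed.

Lemma past_itvcc d n : positive d -> 0 <= past d n <= 1.
Proof.
by move=> pd; apply: mobius_itvcc; rewrite ?all_rev ?factor_pos ?lexx ?ler01.
Qed.

Lemma inv_cf d : positive d -> (cf R d)^-1 = (d 0)%:R + cf R (seq_shift 1 d).
Proof. by move=> pd; rewrite cf_rec // invrK. Qed.

Lemma lambdaE d n : positive d ->
  lambda d n = (d n)%:R + cf R (seq_shift n.+1 d) + past d n.
Proof.
move=> pd; rewrite /lambda inv_cf; last exact: positive_shift.
by rewrite shift_shift /seq_shift addn0 addn1.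
Qed.

Lemma digit_le_lambda d n : positive d -> (d n)%:R <= lambda d n.
Proof.
move=> pd; rewrite lambdaE // -addrA lerDl addr_ge0 //.
  by have /andP[] := cf_itvcc R (positive_shift n.+1 pd).
by have /andP[] := past_itvcc n pd.
Qed.

(** Up to [e], a Perron value depends only on a window of bounded length. *)
Lemma lambda_local (e : R) : 0 < e -> exists m, forall d d' p p',
  positive d -> positive d' ->
  (forall i, (i < m + m)%N -> d (p + i)%N = d' (p' + i)%N) ->
  `|lambda d (p + m) - lambda d' (p' + m)| < e.
Proof.
move=> e0; have e20 : 0 < e / 2 by rewrite divr_gt0.
have [n1 h1] := cf_continuous e20; have [n2 h2] := quarter_small e20.
exists (n1 + n2.*2).+1 => d d' p p' pd pd' dd'; set m := (n1 + n2.*2).+1.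
rewrite !lambdaE // !pastD.
have -> : d' (p' + m)%N = d (p + m)%N by rewrite dd' // /m; lia.
have -> : factor d' p' m = factor d p m.
  apply/eq_in_map => i; rewrite mem_iota /seq_shift => /andP[_ im].
  by rewrite dd' //; lia.
have pm : all_pos (rev (factor d p m)) by rewrite all_rev factor_pos.
have nm : (n2.*2 <= size (rev (factor d p m)))%N.
  by rewrite size_rev size_factor /m; lia.
have := mobius_close pm nm (past_itvcc p pd) (past_itvcc p' pd').
have /h1 : forall i, (i < n1)%N -> seq_shift (p + m).+1 d i = seq_shift (p' + m).+1 d' i.
  move=> i im; rewrite /seq_shift !addSnnS -!addnA dd' // /m; lia.
move=> /(_ (positive_shift _ pd) (positive_shift _ pd')).
rewrite !ltr_norml ler_norml; lra.
Qed.

(** For every [N], the windows of length [K] that start late enough in [d] also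
    occur in [d'] after position [N]. *)
Definition shadowed K d d' := forall N, exists n0, forall n, (n0 <= n)%N ->
  exists2 n', (N <= n')%N & forall i, (i < K)%N -> d (n + i)%N = d' (n' + i)%N.

(** If [d] is shadowed by [d'] at a large enough scale, its upper limit exceeds
    that of [d'] by at most [e]. *)
Lemma limsup_shadowed (e : R) : 0 < e -> exists K, forall d d' v v',
  positive d -> positive d' ->
  is_limsup (lambda d) v -> is_limsup (lambda d') v' ->
  shadowed K d d' -> v <= v' + e.
Proof.
move=> e0; have [m hm] := lambda_local e0; exists (m + m)%N.
move=> d d' v v' pd pd' [_ dv] [dv' _] sdd'.
apply/ler_addgt0Pr => e' e'0.
have e20 : 0 < e' / 2 by rewrite divr_gt0.
have [N hN] := dv' _ e20; have [n0 h0] := sdd' N.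
have [n n0n hn] := dv _ e20 (n0 + m)%N.
have [|n' Nn' h] := h0 (n - m)%N; first lia.
have := hm _ _ _ _ pd pd' h; have := hN (n' + m)%N.
rewrite subnK; last lia.
by move=> /(_ (leq_trans Nn' (leq_addr _ _))); rewrite ltr_norml; lra.
Qed.

Lemma limsup_tail_le d d' p p' v v' : positive d -> positive d' ->
  (forall i, d (p + i)%N = d' (p' + i)%N) ->
  is_limsup (lambda d) v -> is_limsup (lambda d') v' -> v <= v'.
Proof.
move=> pd pd' dd' dv dv'; apply/ler_addgt0Pr => e e0.
have [K hK] := limsup_shadowed e0; apply: (hK d d') => // N.
exists (p + N)%N => n pn; exists (p' + (n - p))%N; first lia.
by move=> i _; rewrite -addnA -dd'; congr d; lia.
Qed.

End LimsupOfLambda.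

(** * Convergents and Legendre's theorem *)

Section LagrangeValue.
Variable R : realType.

(** The sequence defined by [s_0 = a], [s_1 = b] and
    [s_(n+2) = d_n * s_(n+1) + s_n]. Numerators of convergents come from the
    initial values [(1, m)] and denominators from [(0, 1)]; the [n]-th convergent
    is thus the quotient of the terms of index [n+1]. *)
Fixpoint continuant (d : nat -> nat) (a b : int) (n : nat) {struct n} : int :=
  match n with
  | 0 => a
  | n1.+1 => match n1 with
             | 0 => b
             | n2.+1 => (d n2)%:Z * continuant d a b n1 + continuant d a b n2
             end
  end.

Lemma continuantSS d a b n : continuant d a b n.+2 =
  (d n)%:Z * continuant d a b n.+1 + continuant d a b n.
Proof. by []. Qed.

Lemma continuant_det d a b a' b' n :
  continuant d a b n.+1 * continuant d a' b' n -
  continuant d a b n * continuant d a' b' n.+1 = (-1) ^+ n * (b * a' - a * b').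
Proof.
elim: n => [|n IH]; first by rewrite mul1r.
by rewrite exprS -mulrA -IH !continuantSS; ring.
Qed.

Lemma intr_lin (a b c e : int) :
  (a * b + c * e)%:~R = a%:~R * b%:~R + c%:~R * e%:~R :> R.
Proof. by rewrite rmorphD !rmorphM. Qed.

Lemma intr_det (a b c e f : int) :
  (a * (b * c - e * f))%:~R = a%:~R * (b%:~R * c%:~R - e%:~R * f%:~R) :> R.
Proof. by rewrite rmorphM rmorphB !rmorphM. Qed.

Section Expansion.
Variables (d : nat -> nat) (m : int).
Hypothesis pd : forall n, (0 < d n)%N.

Let p := continuant d 1 m.
Let q := continuant d 0 1.
Let x n : R := cf R (seq_shift n d).
Let alpha : R := m%:~R + cf R d.
Let err n : R := (q n)%:~R * alpha - (p n)%:~R.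

Lemma denominator_gt0 n : 0 < q n.+1 /\ 0 <= q n.
Proof.
elim: n => [//|n [IH1 IH2]]; rewrite [q n.+2]continuantSS -/(q n.+1) -/(q n).
by have := pd n; split; [nia | lia].
Qed.

Lemma denominator_ge n : n%:Z <= q n.+1.
Proof.
elim: n => [//|[|n] IH]; first by have := pd 0; rewrite /q /=; lia.
rewrite [q n.+3]continuantSS -/(q n.+2) -/(q n.+1).
have [q1 q0] := denominator_gt0 n.+1; have [q2 _] := denominator_gt0 n.
by have := pd n.+1; nia.
Qed.

Lemma convergent_det n :
  p n.+1 * q n - p n * q n.+1 = (-1) ^+ n.+1.
Proof. by rewrite continuant_det mul1r mulr0 sub0r exprS; ring. Qed.

Lemma tail_itv n : 0 < x n < 1.
Proof. exact/cf_itvoo/positive_shift. Qed.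

Lemma tail_rec n : (x n)^-1 = (d n)%:R + x n.+1.
Proof.
rewrite /x inv_cf; last exact: positive_shift.
by rewrite shift_shift /seq_shift addn0 addn1.
Qed.

Lemma err_rec n : err n.+1 = - x n * err n.
Proof.
elim: n => [|n IH].
  by rewrite /err /alpha /p /q /x /=; have -> : seq_shift 0 d = d by []; ring.
have /andP[x0 _] := tail_itv n.
have xn : x n * ((d n)%:R + x n.+1) = 1.
  by rewrite -tail_rec mulfV // lt0r_neq0.
have -> : err n.+2 = (d n)%:R * err n.+1 + err n.
  rewrite /err [q n.+2]continuantSS [p n.+2]continuantSS -/(q n) -/(p n).
  by rewrite -/(q n.+1) -/(p n.+1) !rmorphD !rmorphM /=; ring.
apply: (mulfI (lt0r_neq0 x0)).
have -> : x n * ((d n)%:R * err n.+1 + err n) =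
  x n * ((d n)%:R + x n.+1) * err n.+1 - x n * x n.+1 * err n.+1 + x n * err n.
  ring.
by rewrite xn; move: IH => ->; ring.
Qed.

Lemma qR_gt0 n : 0 < (q n.+1)%:~R :> R.
Proof. by rewrite ltr0z; case: (denominator_gt0 n). Qed.

(** The past of a digit sequence is the quotient of consecutive denominators. *)
Lemma past_convergent n : past R d n = (q n)%:~R / (q n.+1)%:~R.
Proof.
elim: n => [|n IH]; first by rewrite /past /= mul0r.
rewrite past_rec IH [q n.+2]continuantSS -/(q n.+1) -/(q n) rmorphD rmorphM /=.
have := qR_gt0 n.+1; rewrite [q n.+2]continuantSS -/(q n.+1) -/(q n).
rewrite rmorphD rmorphM /=; have := qR_gt0 n => q0 q1.
by field; apply/andP; split; apply: lt0r_neq0.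
Qed.

(** The scaled error [|q * alpha - p| * q] of a convergent [p / q] is the inverse of
    a Perron value. *)
Lemma convergent_err n :
  `|err n.+1| * (q n.+1)%:~R * lambda R d n = 1.
Proof.
have /andP[x0 x1] := tail_itv n; have q1 := qR_gt0 n.
have q0 : 0 <= (q n)%:~R :> R by rewrite ler0z; case: (denominator_gt0 n).
have E : err n.+1 * ((q n.+1)%:~R + (q n)%:~R * x n) = (-1) ^+ n * x n.
  have H := err_rec n.
  have -> : (-1) ^+ n = (p n)%:~R * (q n.+1)%:~R - (p n.+1)%:~R * (q n)%:~R :> R.
    have := congr1 (fun z : int => z%:~R : R) (convergent_det n).
    by rewrite !(rmorphB, rmorphM, rmorphXn) /= exprS; lra.
  have -> : err n.+1 * ((q n.+1)%:~R + (q n)%:~R * x n) =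
      (q n.+1)%:~R * (err n.+1 + x n * err n) +
      ((p n)%:~R * (q n.+1)%:~R - (p n.+1)%:~R * (q n)%:~R) * x n.
    by rewrite /err; ring.
  by rewrite H; ring.
have -> : lambda R d n = ((q n.+1)%:~R + (q n)%:~R * x n) / ((q n.+1)%:~R * x n).
  rewrite /lambda past_convergent -/(x n).
  by field; apply/andP; split; apply: lt0r_neq0.
have s0 : 0 <= ((q n.+1)%:~R + (q n)%:~R * x n) by nra.
have -> : `|err n.+1| * (q n.+1)%:~R *
    (((q n.+1)%:~R + (q n)%:~R * x n) / ((q n.+1)%:~R * x n)) =
    `|err n.+1| * ((q n.+1)%:~R + (q n)%:~R * x n) / x n.
  by field; apply/andP; split; apply: lt0r_neq0.
rewrite -{1}(ger0_norm s0) -normrM E normrM normrX normrN1 expr1n mul1r.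
by rewrite gtr0_norm // divff // lt0r_neq0.
Qed.

Lemma lambda_ge1 n : 1 <= lambda R d n.
Proof.
by apply: le_trans (digit_le_lambda R n pd); rewrite ler1n.
Qed.

Lemma err_neq0 n : err n != 0.
Proof.
elim: n => [|n IH]; first by rewrite /err /q /p /= mul0r sub0r oppr_eq0 oner_eq0.
rewrite err_rec mulf_neq0 // oppr_eq0; apply: lt0r_neq0.
by case/andP: (tail_itv n).
Qed.

(** If [alpha = a / b], then [b * err n] would be a nonzero integer that tends
    to zero. *)
Lemma cf_irrational : irrational alpha.
Proof.
move=> /rationalP[a [b ab]].
have b0 : (0 < b)%N.
  case: b ab => [|//]; rewrite invr0 mulr0 => a0.
  have := congr1 (fun y => y - m%:~R) a0; rewrite /alpha addrC addKr => c0.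
  have /andP[c1 c2] := cf_itvoo R pd.
  move: c1 c2; rewrite c0 sub0r -rmorphN /= ltr0z ltrz1; lia.
pose z := q b.+2 * a - p b.+2 * b%:Z.
have bR : 0 < b%:R :> R by rewrite ltr0n.
have zE : z%:~R = b%:R * err b.+2.
  rewrite /err ab /z rmorphB !rmorphM /=; field; exact: lt0r_neq0.
have z0 : z != 0.
  apply/eqP => z0; move: zE; rewrite z0 => /esym/eqP.
  by rewrite mulf_eq0 (negPf (err_neq0 _)) (negPf (lt0r_neq0 bR)).
have : 1 <= `|z%:~R| :> R.
  by rewrite -intr_norm ler1z; lia.
rewrite zE normrM (gtr0_norm bR).
have := convergent_err b.+1; have := lambda_ge1 b.+1.
have : b.+1%:R <= (q b.+2)%:~R :> R.
  by have := denominator_ge b.+1; rewrite -(ler_int R).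
have := normr_ge0 (err b.+2); rewrite -natr1.
set e := `|_|; set Q := _%:~R; set l := lambda _ _ _ => e0 Qb l1 E H.
have : e * Q <= 1 by nra.
nra.
Qed.

Lemma denominator_bracket (Q : int) : 0 < Q ->
  exists n, q n.+1 <= Q < q n.+2.
Proof.
move=> Q0; have exk : exists k, Q < q k.+1.
  by exists `|Q|.+1%N; have := denominator_ge `|Q|.+1; lia.
case: (ex_minnP exk) => -[|n] Qq mn; first by move: Qq; rewrite /q /=; lia.
exists n; rewrite Qq andbT leNgt; apply/negP => /mn; lia.
Qed.

(** Legendre's theorem: a reduced fraction [P / Q] whose scaled error is below
    [1/2] is a convergent. In the basis of two consecutive convergents around
    [Q], the coordinates [u] and [v] of [(P, Q)] have opposite signs unless
    [v = 0]. *)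
Lemma legendre (P Q : int) : 0 < Q -> coprimez P Q ->
  `|Q%:~R * alpha - P%:~R| * Q%:~R < 2^-1 ->
  exists n, P = p n.+1 /\ Q = q n.+1.
Proof.
move=> Q0 cPQ PQ; have [n /andP[q1Q Qq2]] := denominator_bracket Q0.
exists n; have det := convergent_det n.+1.
have [q10 _] := denominator_gt0 n; have [q20 _] := denominator_gt0 n.+1.
have ss : (-1) ^+ n.+2 * (-1) ^+ n.+2 = 1 :> int.
  by rewrite -expr2 sqrr_sign.
move: det ss; set s := (-1) ^+ n.+2 => det ss.
pose u := s * (p n.+2 * Q - q n.+2 * P); pose v := s * (P * q n.+1 - Q * p n.+1).
have Pu : P = u * p n.+1 + v * p n.+2.
  transitivity (s * (p n.+2 * q n.+1 - p n.+1 * q n.+2) * P).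
    by rewrite det ss mul1r.
  by rewrite /u /v; ring.
have Qu : Q = u * q n.+1 + v * q n.+2.
  transitivity (s * (p n.+2 * q n.+1 - p n.+1 * q n.+2) * Q).
    by rewrite det ss mul1r.
  by rewrite /u /v; ring.
have vdef : v = s * (P * q n.+1 - Q * p n.+1) by [].
have s1 : `|s%:~R| = 1 :> R by rewrite /s rmorphXn /= normrX normrN1 expr1n.
clearbody u v s; have [v0|v0] := eqVneq v 0.
  move: Pu Qu; rewrite v0 !mul0r !addr0 => Pu Qu.
  suff u1 : u = 1 by rewrite Pu Qu u1 !mul1r.
  have : (u %| gcdz P Q)%Z.
    rewrite dvdz_gcd {1}Pu Qu; apply/andP; split; apply/dvdzP.
      by exists (p n.+1); exact: mulrC.
    by exists (q n.+1); exact: mulrC.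
  by rewrite (eqP cPQ : gcdz P Q = 1) dvdz1 => /eqP; nia.
exfalso.
have x01 := tail_itv n.+1.
have errE : Q%:~R * alpha - P%:~R = err n.+1 * (u%:~R - v%:~R * x n.+1).
  have -> : Q%:~R * alpha - P%:~R = u%:~R * err n.+1 + v%:~R * err n.+2.
    have PR : P%:~R = u%:~R * (p n.+1)%:~R + v%:~R * (p n.+2)%:~R :> R.
      by rewrite Pu intr_lin.
    have QR : Q%:~R = u%:~R * (q n.+1)%:~R + v%:~R * (q n.+2)%:~R :> R.
      by rewrite Qu intr_lin.
    by rewrite PR QR /err; ring.
  by rewrite (err_rec n.+1); ring.
have uv : (1 <= u /\ v <= -1) \/ (u <= -1 /\ 1 <= v) by nia.
have uvx : 1 <= `|u%:~R - v%:~R * x n.+1|.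
  case: uv => -[]; rewrite -!(ler_int R) !rmorphN /= => u1 v1.
    by rewrite ger0_norm; nra.
  by rewrite ler0_norm; nra.
set E := `|Q%:~R * alpha - P%:~R| in PQ.
have errE' : `|err n.+1| <= E.
  by rewrite /E errE normrM ler_peMr.
have vE : v%:~R = s%:~R * ((q n.+1)%:~R * (P%:~R - Q%:~R * alpha) + Q%:~R * err n.+1).
  by rewrite vdef intr_det /err; ring.
have : 1 <= `|v%:~R| :> R by rewrite -intr_norm ler1z; lia.
rewrite vE normrM s1 mul1r => /le_trans/(_ (ler_normD _ _)).
rewrite !normrM [`|P%:~R - _|]distrC -/E.
have q1R := qR_gt0 n; have QR : 0 < Q%:~R :> R by rewrite ltr0z.
rewrite (gtr0_norm q1R) (gtr0_norm QR).
have : (q n.+1)%:~R <= Q%:~R :> R by rewrite ler_int.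
have E0 : 0 <= E by apply: normr_ge0.
nra.
Qed.

End Expansion.
End LagrangeValue.

(** * The Lagrange spectrum as a set of upper limits *)

Section LagrangeLimsup.
Variable R : realType.

Section Expansion.
Variables (d : nat -> nat) (m : int).
Hypothesis pd : forall n, (0 < d n)%N.

Let p := continuant d 1 m.
Let q := continuant d 0 1.
Let alpha : R := m%:~R + cf R d.

(** The convergents of [alpha]. *)
Definition convergent n : rat := (p n.+1)%:~R / (q n.+1)%:~R.

Lemma convergent_coprime n : coprime `|p n.+1| `|q n.+1|.
Proof.
have det := convergent_det d m n.
rewrite -coprimezE; apply/coprimezP.
exists ((-1) ^+ n.+1 * q n, - ((-1) ^+ n.+1 * p n)) => /=.
transitivity ((-1) ^+ n.+1 * (p n.+1 * q n - p n * q n.+1)); first by ring.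
by rewrite det -expr2 sqrr_sign.
Qed.

Lemma numq_convergent n : numq (convergent n) = p n.+1.
Proof.
rewrite coprimeq_num ?convergent_coprime // gtr0_sg ?mul1r //.
by case: (denominator_gt0 pd n).
Qed.

Lemma denq_convergent n : denq (convergent n) = q n.+1.
Proof.
rewrite coprimeq_den ?convergent_coprime //.
have [q0 _] := denominator_gt0 pd n.
by rewrite (negPf (lt0r_neq0 q0)) gtr0_norm.
Qed.

(** The approximation inequality in terms of the scaled error. *)
Lemma approx_solutionsE (a k : R) (r : rat) : 0 < k ->
  approx_solutions a k r <->
  k * (`|(denq r)%:~R * a - (numq r)%:~R| * (denq r)%:~R) < 1.
Proof.
move=> k0; rewrite /approx_solutions /=.
have D0 : 0 < (denq r)%:~R :> R by rewrite ltr0z denq_gt0.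
have -> : ratr r = (numq r)%:~R / (denq r)%:~R :> R by [].
have -> : a - (numq r)%:~R / (denq r)%:~R =
    ((denq r)%:~R * a - (numq r)%:~R) / (denq r)%:~R.
  by field; apply: lt0r_neq0.
rewrite normrM normfV (gtr0_norm D0) ltr_pdivlMr; last first.
  by rewrite mulr_gt0 // exprn_gt0.
set E := `|_|; set D := (denq r)%:~R.
have -> // : E / D * (k * D ^+ 2) = k * (E * D).
by rewrite /D; field; apply: lt0r_neq0.
Qed.

Lemma convergent_solution k n : 0 < k ->
  approx_solutions alpha k (convergent n) <-> k < lambda R d n.
Proof.
move=> k0; rewrite approx_solutionsE // numq_convergent denq_convergent.
have := convergent_err R m pd n; have := lambda_ge1 R pd n.
set E := `|_| * _; set l := lambda _ _ _ => l1 El.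
have E0 : 0 < E by nra.
by rewrite -El mulrC ltr_pM2l.
Qed.

Lemma frequently_infinite_solutions k : 0 < k ->
  (forall N, exists2 n, (N <= n)%N & k < lambda R d n) ->
  infinite_set (approx_solutions alpha k).
Proof.
move=> k0 freq /finite_seqP[s sE].
have [n Nn kn] := freq (\sum_(r <- s) `|denq r|).+1%N.
have := (convergent_solution n k0).2 kn; rewrite sE /= => rs.
have := denominator_ge pd n; rewrite -/(q n.+1) -denq_convergent.
have : (`|denq (convergent n)| <= \sum_(r <- s) `|denq r|)%N.
  by rewrite (big_rem _ rs) leq_addr.
lia.
Qed.

Lemma infinite_solutions_frequently k : 2 <= k ->
  infinite_set (approx_solutions alpha k) ->
  forall N, exists2 n, (N <= n)%N & k < lambda R d n.
Proof.
move=> k2 inf N; have k0 : 0 < k by lra.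
apply: contrapT => H; apply: inf.
apply: (@sub_finite_set _ _ (convergent @` `I_N)); last first.
  exact/finite_image/finite_II.
move=> r rk; have := rk; rewrite (approx_solutionsE _ _ k0) => rk'.
have [n [pE qE]] : exists n, numq r = p n.+1 /\ denq r = q n.+1.
  apply: (legendre (R := R) pd (denq_gt0 r)); first by have := coprime_num_den r.
  rewrite -/alpha; set E := `|_| * _ in rk' *.
  have E0 : 0 <= E.
    by rewrite /E mulr_ge0 ?normr_ge0 // ler0z ltW // denq_gt0.
  have : 2 * E <= k * E by rewrite ler_wpM2r.
  lra.
have rE : convergent n = r by rewrite -[r]divq_num_den pE qE.
exists n => //=; rewrite ltnNge; apply/negP => Nn; apply: H; exists n => //.
by apply/(convergent_solution n k0); rewrite rE.
Qed.

(** This crude form of Hurwitz's theorem makes Legendre's theorem, which needs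
    [2 <= k], sufficient to compute Lagrange values. *)
Lemma frequently_lambda_ge2 N : exists2 n, (N <= n)%N & 2 <= lambda R d n.
Proof.
have [[n Nn dn]|H] := pselect (exists2 n, (N <= n)%N & (2 <= d n)%N).
  by exists n => //; apply: le_trans (digit_le_lambda R n pd); rewrite ler_nat.
have d1 n : (N <= n)%N -> d n = 1%N.
  move=> Nn; apply/eqP; rewrite eqn_leq pd andbT leqNgt.
  by apply/negP => dn; apply: H; exists n.
exists N.+1 => //; rewrite lambdaE // past_rec !d1 //.
rewrite cf_rec; last exact: positive_shift.
rewrite {1}/seq_shift addn0 d1 ?(leq_trans (leqnSn N)) //.
have half (t : R) : 0 <= t <= 1 -> 2^-1 <= (1%:R + t)^-1.
  by move=> t01; rewrite lef_pV2 ?posrE; lra.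
have := half _ (past_itvcc R N pd).
have := half _ (cf_itvcc R (positive_shift 1 (positive_shift N.+2 pd))).
lra.
Qed.

Lemma lagrange_value_limsup v :
  lagrange_value alpha = v%:E <-> is_limsup (lambda R d) v.
Proof.
split=> [lv|[ub fr]].
- have adm k : 0 < k -> infinite_set (approx_solutions alpha k) -> k <= v.
    move=> k0 ki; rewrite -lee_fin -lv; apply: ereal_sup_ubound.
    by exists k.
  split=> e e0; last first.
    move=> N; have : ((v - e)%:E < lagrange_value alpha)%E.
      by rewrite lv lte_fin; lra.
    move=> /ereal_sup_gt[_ [k [k0 ki] <-]]; rewrite lte_fin => vk.
    have [k2|k2] := leP 2 k.
      have [n Nn kn] := infinite_solutions_frequently k2 ki N.
      by exists n => //; lra.
    by have [n Nn kn] := frequently_lambda_ge2 N; exists n => //; lra.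
  apply: contrapT => H.
  have v0 : 0 < v.
    have : ((v - 1)%:E < lagrange_value alpha)%E.
      by rewrite lv lte_fin; lra.
    move=> /ereal_sup_gt[_ [k [k0 ki] <-]] _.
    by have := adm k k0 ki; lra.
  have ve0 : 0 < v + e / 2 by lra.
  suff : v + e / 2 <= v by lra.
  apply/(adm _ ve0)/frequently_infinite_solutions => // N.
  apply: contrapT => H2; apply: H; exists N => n Nn.
  rewrite ltNge; apply/negP => ven; apply: H2; exists n => //; lra.
- have v2 : 2 <= v.
    apply/ler_addgt0Pr => e /ub[N hN]; have [n Nn n2] := frequently_lambda_ge2 N.
    by have := hN n Nn; lra.
  apply/eqP; rewrite eq_le; apply/andP; split.
    apply: ge_ereal_sup => _ [k [k0 ki] <-]; rewrite lee_fin leNgt.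
    apply/negP => vk; have k2 : 2 <= k by lra.
    have kv0 : 0 < k - v by lra.
    have [N hN] := ub _ kv0.
    have [n Nn kn] := infinite_solutions_frequently k2 ki N.
    by have := hN n Nn; lra.
  apply/lee_addgt0Pr => e e0; pose e' := Num.min e 1.
  have e'0 : 0 < e' by rewrite /e' lt_min e0 ltr01.
  have e'1 : e' <= 1 by rewrite /e' ge_min lexx orbT.
  have e'e : e' <= e by rewrite /e' ge_min lexx.
  have ve0 : 0 < v - e' by lra.
  have : ((v - e')%:E <= lagrange_value alpha)%E.
    apply: ereal_sup_ubound; exists (v - e') => //; split => //.
    exact/frequently_infinite_solutions/fr.
  rewrite EFinB leeBlDr // => /le_trans; apply.
  by rewrite leeD2l // lee_fin.
Qed.
End Expansion.

(** The digits are the integer parts of the complete quotients. *)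
Lemma irrational_expansion (a : R) : irrational a ->
  exists (m : int) (d : nat -> nat),
    (forall n, (0 < d n)%N) /\ a = m%:~R + cf R d.
Proof.
move=> irra; pose x := fix x n : R :=
  if n is n'.+1 then (x n')^-1 - (Num.floor (x n')^-1)%:~R
  else a - (Num.floor a)%:~R.
have frac (y : R) : irrational y ->
    0 < y - (Num.floor y)%:~R < 1 /\ irrational (y - (Num.floor y)%:~R).
  move=> iy; have iy' : irrational (y - (Num.floor y)%:~R).
    move=> [r _ rE]; apply: iy; exists (r + (Num.floor y)%:~R) => //.
    by rewrite rmorphD /= ratr_int rE subrK.
  split=> //; have /andP[] := floor_itv y; rewrite rmorphD /= => y0 y1.
  rewrite lt_neqAle subr_ge0 y0 andbT; apply/andP; split; last by lra.
  by apply/eqP => y00; apply: iy'; exists 0; rewrite // rmorph0.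
have xP n : 0 < x n < 1 /\ irrational (x n).
  elim: n => [|n [/andP[x0 x1] ix]]; first exact: frac.
  apply: frac => -[r _ rE]; apply: ix; exists r^-1 => //.
  by rewrite fmorphV /= rE invrK.
pose d n := `|Num.floor (x n)^-1|%N.
have fl n : 1 <= Num.floor (x n)^-1.
  have [/andP[x0 x1] _] := xP n.
  by rewrite floor_ge_int rmorph1 invf_ge1 // ltW.
have dE n : (d n)%:R = (Num.floor (x n)^-1)%:~R :> R.
  rewrite /d -[in RHS](@gez0_abs (Num.floor (x n)^-1)) //.
  by have := fl n; lia.
have pd n : (0 < d n)%N by have := fl n; rewrite /d; lia.
exists (Num.floor a), d; split=> //.
rewrite -(@cf_digits_unique R d x) /=; first by rewrite addrC subrK.
  exact: pd.
move=> n; have [/andP[x0 x1] _] := xP n; split; first by rewrite !ltW.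
by rewrite dE /= addrC subrK invrK.
Qed.

(** Perron's formula for the Lagrange spectrum. *)
Lemma lagrange_spectrumP (v : R) : lagrange_spectrum R v <->
  exists2 d : nat -> nat, (forall n, (0 < d n)%N) & is_limsup (lambda R d) v.
Proof.
split=> [[a /irrational_expansion[m [d [pd ->]]] lv]|[d pd dv]].
  by exists d => //; apply/(lagrange_value_limsup m pd).
exists (0%:~R + cf R d); first exact: cf_irrational.
exact/(lagrange_value_limsup 0 pd).
Qed.

End LagrangeLimsup.

(** * Monotonicity and extrema *)

Section Monotonicity.
Variable R : realType.
Implicit Types (w : seq nat) (x y : R).

Lemma mobius_ge0 w x : 0 <= x -> 0 <= mobius w x.
Proof.
by move=> x0; elim: w => [//|a w IH]; rewrite mobius_cons invr_ge0 addr_ge0 ?ler0n.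
Qed.

Lemma mobius_lt w x y : all_pos w -> 0 <= x -> x < y ->
  if odd (size w) then mobius w y < mobius w x else mobius w x < mobius w y.
Proof.
move=> + x0 xy; have y0 : 0 <= y by lra.
elim: w => [//|a w IH] /andP[a0 /IH]; 
rewrite !mobius_cons (_ : odd (size (a :: w)) = ~~ odd (size w)) // if_neg.
have := mobius_ge0 w x0; have := mobius_ge0 w y0; have := ler1_digit R a0.
case: (odd _) => a1 h1 h2 h3; rewrite ltf_pV2 ?posrE; lra.
Qed.

Lemma mobius_inj w x y : all_pos w -> 0 <= x -> 0 <= y ->
  mobius w x = mobius w y -> x = y.
Proof.
move=> pw x0 y0 E; have [xy|yx|//] := ltgtP x y.
  by have := mobius_lt pw x0 xy; rewrite E; case: ifP; rewrite ltxx.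
by have := mobius_lt pw y0 yx; rewrite E; case: ifP; rewrite ltxx.
Qed.

(** The cylinders of two distinct words of the same length lie on either side of
    each other. *)
Lemma mobius_dominance w1 w2 : all_pos w1 -> all_pos w2 ->
  size w1 = size w2 -> w1 != w2 ->
  (forall x y, 0 < x < 1 -> 0 < y < 1 -> mobius w1 x < mobius w2 y) \/
  (forall x y, 0 < x < 1 -> 0 < y < 1 -> mobius w2 x < mobius w1 y).
Proof.
elim: w1 w2 => [|a w1 IH] [|b w2] // /andP[a0 pw1] /andP[b0 pw2] [sw] nw.
have a1 := ler1_digit R a0; have b1 := ler1_digit R b0.
have first_digit a' b' u1 u2 : (a' < b')%N -> all_pos u1 -> all_pos u2 ->
    forall x y, 0 < x < 1 -> 0 < y < 1 ->
    mobius (b' :: u2) x < mobius (a' :: u1) y.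
  rewrite -addn1 -(ler_nat R) natrD => ab pu1 pu2 x y x01 y01.
  rewrite !mobius_cons.
  have := mobius_itvoo pu2 x01; have := mobius_itvoo pu1 y01 => h1 h2.
  have := ler0n R a' => a'0.
  by rewrite ltf_pV2 ?posrE; lra.
have [ab|ba|ab] := ltngtP a b.
- by right; exact: first_digit.
- by left; exact: first_digit.
- have nw' : w1 != w2 by apply: contra nw => /eqP ->; rewrite ab.
  rewrite -ab; case: (IH w2 pw1 pw2 sw nw') => H; [right|left] => x y x01 y01;
    rewrite !mobius_cons; have := H y x y01 x01;
    have := mobius_itvoo pw1 x01; have := mobius_itvoo pw1 y01;
    have := mobius_itvoo pw2 x01; have := mobius_itvoo pw2 y01;
    by move=> *; rewrite ltf_pV2 ?posrE; lra.
Qed.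

End Monotonicity.

(** An abstract extremum principle. Sequences of booleans are coded by reals
    through [V], where prefixing a letter [b] acts by an increasing map [T b];
    the images under [T c] lie above those under the other map. Then [V] is
    largest at the constant sequence [c], and stays away from this maximum on
    the sequences that show the other letter early. *)
Section CodedExtremum.
Variable R : realType.
Variables (T : bool -> R -> R) (V : (nat -> bool) -> R) (c : bool).
Hypothesis Vrec : forall r, V r = T (r 0%N) (V (seq_shift 1 r)).
Hypothesis V01 : forall r, 0 < V r < 1.
Hypothesis Tmono : forall b x y, 0 <= x -> x < y -> y <= 1 -> T b x < T b y.
Hypothesis Tdom : forall x y, 0 < x < 1 -> 0 < y < 1 -> T (~~ c) x < T c y.
Hypothesis Vcont : forall e : R, 0 < e -> exists n, forall r r',
  (forall i, (i < n)%N -> r i = r' i) -> `|V r - V r'| < e.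

Let Tle b x y : 0 <= x -> x <= y -> y <= 1 -> T b x <= T b y.
Proof.
move=> x0; rewrite le_eqVlt => /orP[/eqP -> //|xy y1].
by rewrite ltW // Tmono.
Qed.

Let top := V (fun=> c).

Let top_fix : T c top = top.
Proof. by rewrite /top [in RHS]Vrec. Qed.

(** Replacing the letters by [c] one after the other does not decrease [V]. *)
Lemma coded_max r : V r <= top.
Proof.
have step n : forall r, V r <= V (fun i => if (i < n)%N then c else r i).
  elim: n => [|n IH] s; first by rewrite le_eqVlt eqxx.
  rewrite Vrec [leRHS]Vrec /=.
  have -> : seq_shift 1 (fun i => if (i < n.+1)%N then c else s i) =
    (fun i => if (i < n)%N then c else seq_shift 1 s i) by apply/funext => i.
  have s1 := V01 (seq_shift 1 s); have := IH (seq_shift 1 s).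
  set s' := (fun _ => _); have s'1 := V01 s' => ss'.
  apply: (@le_trans _ _ (T c (V (seq_shift 1 s)))).
    have [->//|sc] := eqVneq (s 0%N) c.
    by rewrite (_ : s 0%N = ~~ c) ?ltW ?Tdom //; case: (s 0%N) c sc => -[].
  by apply: Tle; lra.
apply/ler_addgt0Pr => e /Vcont[n hn].
have := hn (fun i => if (i < n)%N then c else r i) (fun=> c).
move=> /(_ _)/wrap[i -> //|]; rewrite ltr_norml => h.
by have := step n r; rewrite /top; lra.
Qed.

(** The bound [h] is a number below the maximum, the same for all sequences with
    a letter other than [c] among the first [K]. *)
Lemma coded_gap K : exists2 h, 0 <= h < top &
  forall r, (exists2 k, (k < K)%N & r k != c) -> V r <= h.
Proof.
elim: K => [|K [h /andP[h0 ht] hK]].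
  by exists 0 => [|r []//]; rewrite lexx; case/andP: (V01 (fun=> c)).
have top01 := V01 (fun=> c); rewrite -/top in top01.
exists (Num.max 0 (Num.max (T (~~ c) top) (T c h))) => [|r [k kK rk]].
  rewrite le_max lexx /= !gt_max; apply/and3P; split; first by lra.
    by rewrite -[ltRHS]top_fix Tdom.
  by rewrite -[ltRHS]top_fix Tmono //; lra.
rewrite Vrec !le_max; apply/orP; right; apply/orP.
have s1 := V01 (seq_shift 1 r).
have [r0|r0] := eqVneq (r 0%N) c; last first.
  left; rewrite (_ : r 0%N = ~~ c); last by case: (r 0%N) c r0 => -[].
  by apply: Tle; [lra|exact: coded_max|lra].
right; rewrite r0; apply: Tle; [lra| |lra].
apply: hK; case: k kK rk => [|k] kK rk; first by rewrite r0 eqxx in rk.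
by exists k.
Qed.

End CodedExtremum.

(** * Sequences of blocks *)

Section Blocks.
Variable R : realType.

(** The concatenation of the words [w (r 0)], [w (r 1)], ..., where both words
    have the length of [w true]. *)
Definition blocks (w : bool -> seq nat) (r : nat -> bool) (n : nat) : nat :=
  nth 0 (w (r (n %/ size (w true))%N)) (n %% size (w true))%N.

Definition block_value w r : R := cf R (blocks w r).

(** Two distinct words of positive digits, of the same even length. Evenness makes
    the Mobius maps of both words increasing. *)
Definition block_code (w : bool -> seq nat) :=
  [/\ forall c, size (w c) = size (w true), ~~ odd (size (w true)),
      forall c, all_pos (w c) & w true != w false].

Lemma block_code_rev w : block_code w -> block_code (rev \o w).
Proof.
move=> [sw ow pw nw]; split => /= [c||c|].
- by rewrite !size_rev sw.
- by rewrite size_rev.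
- by rewrite all_rev.
- by apply: contra nw => /eqP/(can_inj revK) ->.
Qed.

Section Fixed.
Variable w : bool -> seq nat.
Hypothesis wP : block_code w.
Let l := size (w true).

Let sw c : size (w c) = l. Proof. by case: wP => ->. Qed.
Let pw c : all_pos (w c). Proof. by case: wP. Qed.

Lemma block_size_ge2 : (2 <= l)%N.
Proof.
case: wP => _ ow _ nw; rewrite /l; move: ow nw (sw false); rewrite /l.
by case: (w true) => [|a [|b s]] //=; case: (w false).
Qed.

Lemma block_size_gt0 : (0 < l)%N.
Proof. exact: ltnW block_size_ge2. Qed.
Let l0 := block_size_gt0.

Lemma blocks_pos r : positive (blocks w r).
Proof.
move=> n; rewrite /blocks -/l; have := pw (r (n %/ l)%N) => /allP; apply.
by rewrite mem_nth // sw ltn_mod.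
Qed.

Lemma blocksE r t j : (j < l)%N -> blocks w r (t * l + j) = nth 0%N (w (r t)) j.
Proof.
by move=> jl; rewrite /blocks -/l divnMDl // divn_small // addn0 modnMDl modn_small.
Qed.

Lemma shift_blocks r t : seq_shift (t * l) (blocks w r) = blocks w (seq_shift t r).
Proof.
by apply/funext => n; rewrite /seq_shift /blocks -/l divnMDl // modnMDl.
Qed.

Lemma factor_blocks r t j : (j <= l)%N ->
  factor (blocks w r) (t * l) j = take j (w (r t)).
Proof.
move=> jl; apply: (@eq_from_nth _ 0%N).
  by rewrite size_factor size_takel ?sw.
move=> i; rewrite size_factor => ij; rewrite nth_mkseq // nth_take // /seq_shift.
by rewrite blocksE //; apply: leq_trans jl.
Qed.

Lemma factor_block r t : factor (blocks w r) (t * l) l = w (r t).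
Proof. by rewrite factor_blocks // take_oversize // sw. Qed.

Lemma block_value_itv r : 0 < block_value w r < 1.
Proof. exact/cf_itvoo/blocks_pos. Qed.

Lemma block_value_rec r :
  block_value w r = mobius (w (r 0%N)) (block_value w (seq_shift 1 r)).
Proof.
rewrite /block_value (cf_mobius R l (blocks_pos r)).
by have := factor_block r 0; rewrite mul0n => ->; rewrite -{1}[l]mul1n shift_blocks.
Qed.

Lemma block_value_continuous (e : R) : 0 < e -> exists n, forall r r',
  (forall i, (i < n)%N -> r i = r' i) ->
  `|block_value w r - block_value w r'| < e.
Proof.
move=> /cf_continuous[n hn]; exists n => r r' rr'; apply: hn => [||i ni].
- exact: blocks_pos.
- exact: blocks_pos.
- by rewrite /blocks -/l rr' // (leq_ltn_trans (leq_div _ _)).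
Qed.

Lemma block_value_inj r r' : block_value w r = block_value w r' -> r = r'.
Proof.
move=> /cf_inj-/(_ (blocks_pos _) (blocks_pos _)) E; apply/funext => t.
have : w (r t) = w (r' t) by rewrite -!factor_block E.
case: wP => _ _ _ nw; case: (r t) (r' t) => -[] // E'; move: nw.
  by rewrite E' eqxx.
by rewrite -E' eqxx.
Qed.

Lemma mobius_block_lt c (x y : R) : 0 <= x -> x < y ->
  mobius (w c) x < mobius (w c) y.
Proof.
move=> x0 xy; have := mobius_lt (pw c) x0 xy; rewrite sw.
by case: wP => _ /negPf ->.
Qed.

Lemma block_value_top : exists c,
  (forall r, block_value w r <= block_value w (fun=> c)) /\
  forall K, exists2 h, 0 <= h < block_value w (fun=> c) &
    forall r, (exists2 k, (k < K)%N & r k != c) -> block_value w r <= h.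
Proof.
have [c dom] : exists c, forall x y : R, 0 < x < 1 -> 0 < y < 1 ->
    mobius (w (~~ c)) x < mobius (w c) y.
  have [||//||h|h] := @mobius_dominance R (w true) (w false); rewrite ?sw //.
    by case: wP.
  by exists false. by exists true.
exists c; split=> [r|K].
  apply: (@coded_max R (fun b => mobius (w b)) (block_value w) c) => //.
  - exact: block_value_rec.
  - exact: block_value_itv.
  - by move=> b x y x0 xy _; exact: mobius_block_lt.
  - exact: block_value_continuous.
apply: (@coded_gap R (fun b => mobius (w b)) (block_value w) c) => //.
- exact: block_value_rec.
- exact: block_value_itv.
- by move=> b x y x0 xy _; exact: mobius_block_lt.
- exact: block_value_continuous.
Qed.

Lemma block_value_bot : exists c,
  (forall r, block_value w (fun=> c) <= block_value w r) /\
  forall K, exists2 h, block_value w (fun=> c) < h <= 1 &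
    forall r, (exists2 k, (k < K)%N & r k != c) -> h <= block_value w r.
Proof.
have [c dom] : exists c, forall x y : R, 0 < x < 1 -> 0 < y < 1 ->
    mobius (w c) x < mobius (w (~~ c)) y.
  have [||//||h|h] := @mobius_dominance R (w true) (w false); rewrite ?sw //.
    by case: wP.
  by exists true. by exists false.
pose T b (x : R) := 1 - mobius (w b) (1 - x); pose V r := 1 - block_value w r.
have Vrec r : V r = T (r 0%N) (V (seq_shift 1 r)).
  by rewrite /V /T block_value_rec subKr.
have V01 r : 0 < V r < 1 by rewrite /V; have := block_value_itv r; lra.
have Tmono b x y : 0 <= x -> x < y -> y <= 1 -> T b x < T b y.
  by move=> x0 xy y1; rewrite /T ltrD2l ltrN2 mobius_block_lt //; lra.
have Tdom x y : 0 < x < 1 -> 0 < y < 1 -> T (~~ c) x < T c y.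
  by move=> x01 y01; rewrite /T ltrD2l ltrN2 dom //; lra.
have Vcont (e : R) : 0 < e -> exists n, forall r r',
    (forall i, (i < n)%N -> r i = r' i) -> `|V r - V r'| < e.
  move=> /block_value_continuous[n hn]; exists n => r r' /hn.
  by rewrite /V !ltr_norml; lra.
exists c; split=> [r|K].
  by have := coded_max Vrec V01 Tmono Tdom Vcont r; rewrite /V; lra.
have [h h01 hK] := coded_gap Vrec V01 Tmono Tdom Vcont K.
exists (1 - h); first by move: h01; rewrite /V; lra.
by move=> r /hK; rewrite /V; lra.
Qed.

(** After any finite word [u], the value of a block sequence is maximal at one of
    the two constant sequences, with a gap on the sequences that show the other
    block early; the parity of the length of [u] decides which of the two
    constant sequences is optimal. *)
Lemma mobius_block_value_top u : all_pos u -> exists c,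
  (forall r, mobius u (block_value w r) <= mobius u (block_value w (fun=> c))) /\
  forall K, exists2 h, h < mobius u (block_value w (fun=> c)) &
    forall r, (exists2 k, (k < K)%N & r k != c) ->
    mobius u (block_value w r) <= h.
Proof.
move=> pu; have v01 := block_value_itv.
have le (x y : R) : 0 <= x -> x <= y ->
    if odd (size u) then mobius u y <= mobius u x else mobius u x <= mobius u y.
  move=> x0; rewrite le_eqVlt => /orP[/eqP ->|xy]; first by rewrite lexx if_same.
  by have := mobius_lt pu x0 xy; case: ifP => _ /ltW.
case ou : (odd (size u)).
- have [c [cmin cgap]] := block_value_bot; exists c; split=> [r|K].
    by have := le _ _ _ (cmin r); rewrite ou; apply; case/andP: (v01 (fun=> c)) => /ltW.
  have [h /andP[ch h1] hK] := cgap K; exists (mobius u h).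
    by have := mobius_lt pu _ ch; rewrite ou; apply; case/andP: (v01 (fun=> c)) => /ltW.
  move=> r /hK hr; have := le h _ _ hr; rewrite ou; apply.
  by have := v01 (fun=> c); lra.
- have [c [cmax cgap]] := block_value_top; exists c; split=> [r|K].
    by have := le _ _ _ (cmax r); rewrite ou; apply; case/andP: (v01 r) => /ltW.
  have [h /andP[h0 hc] hK] := cgap K; exists (mobius u h).
    by have := mobius_lt pu h0 hc; rewrite ou.
  move=> r /hK hr; have := le _ _ _ hr; rewrite ou; apply.
  by case/andP: (v01 r) => /ltW.
Qed.

End Fixed.
End Blocks.

(** * Perron values of block sequences *)

Section BiInfinite.
Variable R : realType.
Variable w : bool -> seq nat.
Hypothesis wP : block_code w.
Let l := size (w true).
Let sw c : size (w c) = l. Proof. by case: wP => ->. Qed.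
Let pw c : all_pos (w c). Proof. by case: wP. Qed.
Let wrP : block_code (rev \o w). Proof. exact: block_code_rev. Qed.
Let l0 : (0 < l)%N. Proof. exact: block_size_gt0. Qed.

(** The Perron value at digit [j] of a block [c] which is followed by the blocks
    [r 0], [r 1], ... and preceded, from right to left, by [p 0], [p 1], .... *)
Definition bilambda c j (r p : nat -> bool) : R :=
  (nth 0%N (w c) j)%:R + mobius (drop j.+1 (w c)) (block_value R w r) +
  mobius (rev (take j (w c))) (block_value R (rev \o w) p).

Let drop_pos c j : all_pos (drop j (w c)).
Proof.
by apply/allP => a /mem_drop; move: a; apply/allP; exact: pw.
Qed.

Let take_pos c j : all_pos (rev (take j (w c))).
Proof.
by rewrite all_rev; apply/allP => a /mem_take; move: a; apply/allP; exact: pw.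
Qed.

Let v01 r : 0 <= block_value R w r <= 1.
Proof. by have := block_value_itv R wP r; lra. Qed.

Let vr01 r : 0 <= block_value R (rev \o w) r <= 1.
Proof. by have := block_value_itv R wrP r; lra. Qed.

(** The finite past of the [t]-th block is close to an infinite one. As [t - 1 - i]
    is truncated, this infinite past repeats the first block forever. *)
Lemma past_blocks b t :
  `|past R (blocks w b) (t * l) -
    block_value R (rev \o w) (fun i => b (t - 1 - i)%N)| <= 4^-1 ^+ t.
Proof.
elim: t => [|t IH].
  rewrite mul0n /past /= expr0 sub0r normrN.
  by rewrite ger0_norm; have := vr01 (fun i => b (0 - 1 - i)%N); lra.
rewrite mulSnr pastD factor_block // block_value_rec // subn1 subn0 /=.
have -> : seq_shift 1 (fun i => b (t - i)%N) = (fun i => b (t - 1 - i)%N).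
  by apply/funext => i; rewrite /seq_shift subnDA.
apply: (@le_trans _ _ (4^-1 ^+ 1 * `|past R (blocks w b) (t * l) -
    block_value R (rev \o w) (fun i => b (t - 1 - i)%N)|)).
  apply: mobius_contract => //.
  - by rewrite all_rev.
  - by rewrite size_rev sw; apply: block_size_ge2.
  - exact/past_itvcc/blocks_pos.
by rewrite expr1 exprS ler_wpM2l // invr_ge0.
Qed.

Lemma lambda_blocks b t j : (j < l)%N ->
  `|lambda R (blocks w b) (t * l + j) -
    bilambda (b t) j (seq_shift t.+1 b) (fun i => b (t - 1 - i)%N)| <= 4^-1 ^+ t.
Proof.
move=> jl; have pb := blocks_pos wP b.
rewrite lambdaE // blocksE // pastD factor_blocks //; last exact: ltnW.
have -> : cf R (seq_shift (t * l + j).+1 (blocks w b)) =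
    mobius (drop j.+1 (w (b t))) (block_value R w (seq_shift t.+1 b)).
  rewrite (cf_mobius R (l - j.+1)) ?shift_shift; last exact: positive_shift.
  rewrite factor_shift addn0 (_ : (_ + (l - j.+1) = t.+1 * l)%N); last first.
    by rewrite -addnS -addnA subnKC // mulSnr.
  rewrite shift_blocks //; congr mobius.
  have := factorD (blocks w b) (t * l) j.+1 (l - j.+1).
  rewrite subnKC // factor_block // factor_blocks // addnS => ->.
  by rewrite drop_size_cat // size_takel // sw.
rewrite /bilambda [X in `|X|](_ : _ =
  mobius (rev (take j (w (b t)))) (past R (blocks w b) (t * l)) -
  mobius (rev (take j (w (b t)))) (block_value R (rev \o w) (fun i => b (t - 1 - i)%N)));
  last by ring.
apply: le_trans (past_blocks b t); apply: mobius_lipschitz => //.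
exact: past_itvcc.
Qed.

Lemma bilambda_continuous (e : R) : 0 < e -> exists n, forall c j r r' p p',
  (forall i, (i < n)%N -> r i = r' i) -> (forall i, (i < n)%N -> p i = p' i) ->
  `|bilambda c j r p - bilambda c j r' p'| < e.
Proof.
move=> e0; have e20 : 0 < e / 2 by lra.
have [n1 h1] := block_value_continuous wP e20.
have [n2 h2] := block_value_continuous wrP e20.
exists (n1 + n2)%N => c j r r' p p' rr' pp'.
have {}h1 : `|block_value R w r - block_value R w r'| < e / 2.
  by apply: h1 => i i1; apply: rr'; lia.
have {}h2 : `|block_value R (rev \o w) p - block_value R (rev \o w) p'| < e / 2.
  by apply: h2 => i i1; apply: pp'; lia.
have := mobius_lipschitz (drop_pos c j.+1) (v01 r) (v01 r').
have := mobius_lipschitz (take_pos c j) (vr01 p) (vr01 p').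
move=> /le_lt_trans/(_ h2) + /le_lt_trans/(_ h1).
by rewrite /bilambda !ltr_norml; lra.
Qed.

Lemma finite_positive_lb (I : finType) (f : I -> R) :
  (forall i, 0 < f i) -> exists2 e, 0 < e & forall i, e <= f i.
Proof.
move=> f0; have [i0 _|I0] := pickP (@predT I); last first.
  by exists 1 => // i; have := I0 i.
case: (@arg_minP _ _ _ i0 predT f isT) => i _ hi.
by exists (f i) => // k; apply: hi.
Qed.

(** The Perron values of all bi-infinite block sequences have a maximum, attained
    at a block [c] with constant future and constant past. There is a gap below
    this maximum for all sequences in which the [K] blocks that follow, or the
    [K] blocks that precede, are not all equal. *)
Lemma bilambda_max : exists c j g h, (j < l)%N /\
  forall K, exists2 delta, 0 < delta &
  forall c' j' r p, (j' < l)%N ->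
  bilambda c' j' r p <= bilambda c j (fun=> g) (fun=> h) /\
  ((exists2 k, (k < K)%N & r k != r 0%N) \/ (exists2 k, (k < K)%N & p k != p 0%N) ->
   bilambda c' j' r p <= bilambda c j (fun=> g) (fun=> h) - delta).
Proof.
have /choice[G hG] : forall i : bool * 'I_l, exists g, 
  (forall r, mobius (drop i.2.+1 (w i.1)) (block_value R w r) <=
    mobius (drop i.2.+1 (w i.1)) (block_value R w (fun=> g))) /\
  forall K, exists2 h, h < mobius (drop i.2.+1 (w i.1)) (block_value R w (fun=> g)) &
    forall r, (exists2 k, (k < K)%N & r k != g) ->
    mobius (drop i.2.+1 (w i.1)) (block_value R w r) <= h.
  by move=> i; exact: mobius_block_value_top.
have /choice[H hH] : forall i : bool * 'I_l, exists g, 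
  (forall r, mobius (rev (take i.2 (w i.1))) (block_value R (rev \o w) r) <=
    mobius (rev (take i.2 (w i.1))) (block_value R (rev \o w) (fun=> g))) /\
  forall K, exists2 h,
    h < mobius (rev (take i.2 (w i.1))) (block_value R (rev \o w) (fun=> g)) &
    forall r, (exists2 k, (k < K)%N & r k != g) ->
    mobius (rev (take i.2 (w i.1))) (block_value R (rev \o w) r) <= h.
  by move=> i; exact: mobius_block_value_top.
pose F (i : bool * 'I_l) := bilambda i.1 i.2 (fun=> G i) (fun=> H i).
case: (@arg_maxP _ _ _ (true, Ordinal l0) predT F isT) => i _ hi.
exists i.1, i.2, (G i), (H i); split=> // K; rewrite -/(F i).
have /choice[D hD] : forall k : bool * 'I_l, exists e, 0 < e /\ forall r p,
    ((exists2 k, (k < K)%N & r k != r 0%N) \/ (exists2 k, (k < K)%N & p k != p 0%N)) ->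
    bilambda k.1 k.2 r p <= F k - e.
  move=> k; have [maxG gapG] := hG k; have [maxH gapH] := hH k.
  have [g gG hg] := gapG K.+1; have [h hh' hh] := gapH K.+1.
  exists (Num.min (mobius (drop k.2.+1 (w k.1)) (block_value R w (fun=> G k)) - g)
    (mobius (rev (take k.2 (w k.1))) (block_value R (rev \o w) (fun=> H k)) - h)).
  split; first by rewrite lt_min !subr_gt0 gG.
  move=> r p; have := maxG r; have := maxH p; rewrite lerBrDl -lerBrDr ge_min.
  (* A non-constant prefix of length K contains a letter other than x. *)
  have ne (s : nat -> bool) x : (exists2 k, (k < K)%N & s k != s 0%N) ->
      exists2 k, (k < K.+1)%N & s k != x.
    move=> [k' kK sk]; have [s0|s0] := eqVneq (s 0%N) x.
      by exists k'; [exact: ltnW|rewrite -s0].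
    by exists 0%N.
  rewrite /F /bilambda => mh mg [/(ne _ (G k))/hg|/(ne _ (H k))/hh] b;
    apply/orP; [left|right]; lra.
have [delta d0 hd] := finite_positive_lb (fun k => (hD k).1).
exists delta => // c' j' r p jl; pose k := (c', Ordinal jl).
have -> : bilambda c' j' r p = bilambda k.1 k.2 r p by [].
have Fk : F k <= F i by apply: hi.
split; last by move=> /((hD k).2 r p); have := hd k; lra.
apply: le_trans Fk; have := (hG k).1 r; have := (hH k).1 p.
by rewrite /F /bilambda; lra.
Qed.

End BiInfinite.

(** * Marked block sequences *)

(** A marker is a block [c] between [N] blocks [h] on the left and [N] blocks [g]
    on the right. Beyond the marker the blocks change all the time: on the left
    they alternate, and on the right they come in pairs of opposite blocks, the
    first block of the [q]-th pair telling whether [q] belongs to the set [P]. *)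
Section MarkedSequences.
Variables (N : nat) (c g h : bool).

(** The blocks to the right of the centre of a marker, from left to right. *)
Definition marker_right (P : set nat) (i : nat) : bool :=
  if (i < N)%N then g else `[< P (i - N)./2%N >] (+) odd (i - N).

(** The blocks to the left of the centre, from right to left. *)
Definition marker_left (i : nat) : bool := if (i < N)%N then h else odd i.

(** The bi-infinite sequence around a marker, from [N] blocks before the centre
    on. *)
Definition marker P (i : nat) : bool :=
  if (i < N)%N then h else if i == N then c else marker_right P (i - N.+1).

(** The blocks that precede position [i] of [marker P], from right to left. *)
Definition marker_past P (i q : nat) : bool :=
  if (q < i)%N then marker P (i - 1 - q) else marker_left (N + q - i).

(** The position of the marker in the [k]-th chunk, which covers the positions
    from [2 ^ k] to [2 ^ k.+1 - 1]. *)
Definition centre (k : nat) : nat := (2 ^ k + (2 ^ k)./2)%N.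

(** The block sequence with the centre of a marker at the middle of each dyadic
    chunk. *)
Definition marked P (n : nat) : bool :=
  let m := centre (trunc_log 2 n) in
  if (n < m)%N then marker_left (m - n.+1)
  else if n == m then c else marker_right P (n - m.+1).

Lemma trunc_log_chunk k n : (2 ^ k <= n < 2 ^ k.+1)%N -> trunc_log 2 n = k.
Proof. by move=> kn; apply: trunc_log_eq. Qed.

Lemma marked_near P k i : (0 < k)%N -> (i < N + (2 ^ k)./2)%N -> (N <= (2 ^ k)./2)%N ->
  marked P (centre k - N + i) = marker P i.
Proof.
move=> k0 iN Nk; have e2 : (2 ^ k = ((2 ^ k)./2).*2)%N.
  by case: k k0 {iN Nk} => // k _; rewrite expnS mul2n doubleK.
rewrite /marked (@trunc_log_chunk k); last by rewrite /centre expnS; lia.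
rewrite /marker /marker_left.
have [iN'|iN'|->] := ltngtP i N.
- rewrite ifT; last by rewrite /centre; lia.
  by rewrite ifT // /centre; lia.
- rewrite ifF; last by rewrite /centre; lia.
  rewrite ifF; last by rewrite /centre; lia.
  by congr marker_right; rewrite /centre; lia.
- rewrite ifF; last by rewrite /centre; lia.
  by rewrite ifT // /centre; lia.
Qed.

Lemma marked_near_left P k n : (0 < k)%N -> (2 ^ k <= n < centre k)%N ->
  marked P n = marker_left (centre k - n.+1).
Proof.
move=> k0 /andP[kn nk]; have e2 : (2 ^ k = ((2 ^ k)./2).*2)%N.
  by case: k k0 {kn nk} => // k _; rewrite expnS mul2n doubleK.
rewrite /marked (@trunc_log_chunk k) ?nk //.
by rewrite kn expnS /=; move: nk; rewrite /centre; lia.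
Qed.

Lemma marked_near_right P k n : (0 < k)%N -> (centre k < n < 2 ^ k.+1)%N ->
  marked P n = marker_right P (n - (centre k).+1).
Proof.
move=> k0 /andP[kn nk]; have e2 : (2 ^ k = ((2 ^ k)./2).*2)%N.
  by case: k k0 {kn nk} => // k _; rewrite expnS mul2n doubleK.
rewrite /marked (@trunc_log_chunk k); last first.
  by rewrite nk andbT; move: kn; rewrite /centre; lia.
by rewrite ifF ?ifF //; lia.
Qed.

(** Among three consecutive blocks beyond a marker on the right, not all are equal,
    because they contain a whole pair. *)
Lemma marker_right_alt P i : (N <= i)%N ->
  marker_right P i != marker_right P i.+1 \/
  marker_right P i.+1 != marker_right P i.+2.
Proof.
move=> Ni; rewrite /marker_right !ifF; try lia.
have -> : (i.+1 - N = (i - N).+1)%N by lia.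
have -> : (i.+2 - N = (i - N).+2)%N by lia.
move: (i - N)%N => n; rewrite /= negbK.
case on : (odd n) => /=; [right|left].
  have -> : uphalf n = (n./2).+1 by rewrite uphalf_half on.
  by case: (asbool _).
have -> : uphalf n = n./2 by rewrite uphalf_half on.
by case: (asbool _).
Qed.

Lemma marker_left_alt i : (N <= i)%N -> marker_left i != marker_left i.+1.
Proof. by move=> Ni; rewrite /marker_left !ifF /=; [case: odd|lia|lia]. Qed.

(** A late block either belongs to a marker, or the [6] blocks that follow it or
    that precede it are not all equal. The length [6] leaves room for [3]
    blocks on one side of a boundary between chunks. *)
Lemma marked_away P : exists T, forall t, (T <= t)%N ->
  (exists k i, [/\ (0 < k)%N, (i <= N + N)%N, (N < (2 ^ k)./2)%N,
    t = (centre k - N + i)%N & (t < 2 ^ k.+1)%N]) \/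
  (exists2 q, (q < 6)%N & marked P (t.+1 + q) != marked P (t.+1 + 0)) \/
  (exists2 q, (q < 6)%N & marked P (t - 1 - q) != marked P (t - 1 - 0)).
Proof.
exists (2 ^ (N + 10))%N => t Tt.
pose k := trunc_log 2 t.
have t0 : (0 < t)%N by apply: leq_trans Tt; rewrite expn_gt0.
have /andP[kt tk] : (2 ^ k <= t < 2 ^ k.+1)%N by apply: trunc_log_bounds.
have kN : (N + 10 <= k)%N by apply: trunc_log_max.
have [k' kk'] : exists k', k = k'.+2 by exists (k - 2)%N; lia.
have k'N : (N + 8 < 2 ^ k')%N.
  by apply: leq_ltn_trans (ltn_expl k' (isT : 1 < 2)%N); lia.
have e0 : (2 ^ k = 4 * 2 ^ k')%N by rewrite kk' !expnS; lia.
have e1 : (2 ^ k.+1 = 8 * 2 ^ k')%N by rewrite kk' !expnS; lia.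
have e2 : (2 ^ k.+2 = 16 * 2 ^ k')%N by rewrite kk' !expnS; lia.
have em : (2 ^ k.-1 = 2 * 2 ^ k')%N by rewrite kk' !expnS.
have h0 : ((2 ^ k)./2 = 2 * 2 ^ k')%N by lia.
have c0 : centre k = (6 * 2 ^ k')%N by rewrite /centre; lia.
have c1 : centre k.+1 = (12 * 2 ^ k')%N by rewrite /centre; lia.
have cm : centre k.-1 = (3 * 2 ^ k')%N by rewrite /centre; lia.
move: (2 ^ k')%N k'N e0 e1 e2 em h0 c0 c1 cm => E EN e0 e1 e2 em h0 c0 c1 cm.
have nonconst (s : nat -> bool) :
    (exists a b, [/\ (a < 6)%N, (b < 6)%N & s a != s b]) ->
    exists2 q, (q < 6)%N & s q != s 0%N.
  move=> [a [b [a6 b6 ab]]]; have [sa|sa] := eqVneq (s a) (s 0%N); last by exists a.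
  by exists b => //; rewrite -sa eq_sym.
have [tl|tl] := ltnP t (centre k - N).
  right; right; pose s q := marked P (t - 1 - q); apply: (nonconst s).
  have [t2|t2] := leqP (2 ^ k + 2)%N t.
    exists 1%N, 0%N; split=> //; rewrite /s !(@marked_near_left P k); try lia.
    rewrite [X in marker_left X != _](_ : _ = (centre k - (t - 1 - 0).+1).+1); last lia.
    by rewrite eq_sym; apply: marker_left_alt; lia.
  pose i := (t - 5 - (centre k.-1).+1)%N.
  have sE q : (2 <= q <= 4)%N -> s q = marker_right P (i + (4 - q)).
    move=> q24; rewrite /s (@marked_near_right P k.-1); first by congr marker_right; lia.
      lia.
    by rewrite prednK; lia.
  have [|ne|ne] := @marker_right_alt P i; first lia.
    by exists 4%N, 3%N; rewrite !sE // subnn addn0 addn1.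
  by exists 3%N, 2%N; rewrite !sE // addn1 addn2.
have [tr|tr] := leqP t (centre k + N).
  left; exists k, (t - (centre k - N))%N; split; lia.
right; left; pose s q := marked P (t.+1 + q); apply: (nonconst s).
have [t2|t2] := leqP (2 ^ k.+1)%N (t + 3).
  exists 3%N, 4%N; split=> //; rewrite /s !(@marked_near_left P k.+1); try lia.
  rewrite [X in marker_left X != _](_ : _ = (centre k.+1 - (t.+1 + 4).+1).+1); last lia.
  by rewrite eq_sym; apply: marker_left_alt; lia.
pose i := (t.+1 - (centre k).+1)%N.
have sE q : (q <= 2)%N -> s q = marker_right P (i + q).
  by move=> q2; rewrite /s (@marked_near_right P k); [congr marker_right; lia|lia|lia].
have [|ne|ne] := @marker_right_alt P i; first lia.
  by exists 0%N, 1%N; rewrite !sE // addn0 addn1.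
by exists 1%N, 2%N; rewrite !sE // addn1 addn2.
Qed.

End MarkedSequences.

(** * Uncountably many upper limits *)

Section MarkedLimsup.
Variable R : realType.
Variable w : bool -> seq nat.
Hypothesis wP : block_code w.
Let l := size (w true).

Section Fixed.
Variables (N : nat) (c g h : bool).

(** The Perron value at digit [j] of block [i] of the bi-infinite marked sequence. *)
Definition marker_value P i j : R :=
  bilambda R w (marker N c g h P i) j (fun q => marker N c g h P (i.+1 + q))
    (marker_past N c g h P i).

Lemma lambda_near_marker P (e : R) : 0 < e -> exists k0, forall k i j,
  (k0 <= k)%N -> (i <= N + N)%N -> (j < l)%N ->
  `|lambda R (blocks w (marked N c g h P)) ((centre k - N + i) * l + j) -
    marker_value P i j| < e.
Proof.
move=> e0; have e20 : 0 < e / 2 by lra.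
have [n hn] := bilambda_continuous wP e20; have [n2 h2] := quarter_small e20.
exists (N + N + n + n2 + 10)%N => k i j k0k iN jl.
have kE : (2 * (N + N + n + n2 + 2) <= 2 ^ k)%N.
  have [k' kk'] : exists k', k = k'.+1 by exists k.-1; lia.
  by rewrite kk' expnS; have := ltn_expl k' (isT : 1 < 2)%N; lia.
set t := (centre k - N + i)%N; set b := marked N c g h P.
have bt : b t = marker N c g h P i by rewrite /b marked_near; lia.
have := lambda_blocks R wP b t jl; rewrite -/l bt => H1.
have /hn H2 : forall q, (q < n)%N ->
    seq_shift t.+1 b q = marker N c g h P (i.+1 + q).
  move=> q qn; rewrite /seq_shift -(@marked_near N c g h P k); try lia.
  by congr (marked _ _ _ _ _ _); rewrite /t; lia.
have /H2 {}H2 : forall q, (q < n)%N -> b (t - 1 - q)%N = marker_past N c g h P i q.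
  move=> q qn; rewrite /marker_past; case: ltnP => qi.
    rewrite -(@marked_near N c g h P k); try lia.
    by congr (marked _ _ _ _ _ _); rewrite /t; lia.
  rewrite /b (@marked_near_left N c g h P k); try lia.
    by congr marker_left; rewrite /t /centre; lia.
  by rewrite /t /centre; lia.
have {}H2 := H2 (marker N c g h P i) j.
have H3 : 4^-1 ^+ t <= 4^-1 ^+ n2 :> R.
  apply: ler_wiXn2l; [lra|lra|].
  by rewrite /t /centre; lia.
move: H1 H2; rewrite /marker_value ler_norml !ltr_norml; lra.
Qed.

(** At a position within the marker the past does not depend on [P], and the future
    determines [P]. *)
Lemma marker_value_inj i j P P' : (i <= N + N)%N -> (j < l)%N ->
  marker_value P i j = marker_value P' i j -> P = P'.
Proof.
move=> iN jl; rewrite /marker_value.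
have E n : (n <= N + N)%N -> marker N c g h P n = marker N c g h P' n.
  move=> nN; rewrite /marker; case: ltnP => // Nn; case: eqP => // nN'.
  have lt : (n - N.+1 < N)%N by lia.
  by rewrite /marker_right lt.
have -> : marker_past N c g h P i = marker_past N c g h P' i.
  by apply/funext => q; rewrite /marker_past; case: ltnP => // qi; rewrite E //; lia.
rewrite E // /bilambda => /addIr/addrI/mobius_inj.
have pos u : 0 <= block_value R w u.
  by have /andP[/ltW] := block_value_itv R wP u.
have dpos : all_pos (drop j.+1 (w (marker N c g h P' i))).
  apply/allP => a /mem_drop; move: a; apply/allP.
  by case: wP.
move=> /(_ dpos (pos _) (pos _))/(block_value_inj wP) EE.
apply/funext => q; apply/propext.
have := congr1 (fun f => f (N + N + q.*2 - i)%N) EE.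
rewrite (_ : i.+1 + (N + N + q.*2 - i) = N.+1 + (N + q.*2))%N; last by lia.
rewrite /marker !ifF; try lia.
rewrite addKn /marker_right !ifF; try lia.
rewrite addKn odd_double doubleK !addbF => qq.
by split=> /asboolP; [rewrite qq|rewrite -qq] => /asboolP.
Qed.

End Fixed.

(** For a long enough marker around an optimal block, the upper limit of the
    Perron values is the largest of the finitely many values taken within the
    marker. *)
Lemma marked_limsup : exists N c g h, exists phi : set nat -> R,
  (forall P, is_limsup (lambda R (blocks w (marked N c g h P))) (phi P)) /\
  forall P, exists i j, [/\ (i <= N + N)%N, (j < l)%N &
    phi P = marker_value N c g h P i j].
Proof.
have [c [j0 [g [h [j0l maxM]]]]] := bilambda_max R wP.
have [delta d0 hd] := maxM 6%N.
have d20 : 0 < delta / 2 by lra.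
have [N hN] := bilambda_continuous wP d20.
exists N, c, g, h; pose M := bilambda R w c j0 (fun=> g) (fun=> h).
have l0 : (0 < l)%N by exact: block_size_gt0.
suff H P : exists v, is_limsup (lambda R (blocks w (marked N c g h P))) v /\
    exists i j, [/\ (i <= N + N)%N, (j < l)%N & v = marker_value N c g h P i j].
  by have [phi hphi] := choice H; exists phi; split=> P; case: (hphi P).
pose F (x : 'I_(N + N).+1 * 'I_l) := marker_value N c g h P x.1 x.2.
have NN : (N < (N + N).+1)%N by lia.
case: (@arg_maxP _ _ _ (Ordinal NN, Ordinal j0l) predT F isT) => x _ hx.
have Fx i j : (i <= N + N)%N -> (j < l)%N -> marker_value N c g h P i j <= F x.
  by move=> iN jl; exact: (hx (Ordinal (iN : (i < (N + N).+1)%N), Ordinal jl)).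
(* The upper limit is the largest value within the marker. *)
exists (F x); split; last first.
  by exists x.1, x.2; split=> //; rewrite -ltnS.
(* The centre of the marker is nearly optimal. *)
have Mx : M - delta / 2 < F x.
  have := Fx N j0 (leq_addr _ _) j0l; rewrite /marker_value.
  have -> : marker N c g h P N = c by rewrite /marker ltnn eqxx.
  have := hN c j0 (fun q => marker N c g h P (N.+1 + q)) (fun=> g)
    (marker_past N c g h P N) (fun=> h).
  rewrite -/M; set z := bilambda _ _ _ _ _ _ => hz.
  have : `|z - M| < delta / 2.
    apply: hz => q qN.
      rewrite /marker !ifF; try lia.
      by rewrite addKn /marker_right qN.
    by rewrite /marker_past qN /marker ifT //; lia.
  by rewrite ltr_norml; lra.
split=> e e0.
  have [k0 hk0] := lambda_near_marker N c g h P e0.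
  have [T hT] := marked_away N c g h P; have [n2 h2] := quarter_small d20.
  exists ((T + 2 ^ k0 + n2) * l)%N => n nT.
  rewrite (divn_eq n l); set t := (n %/ l)%N; set j := (n %% l)%N.
  have jl : (j < l)%N by rewrite ltn_mod.
  have tT : (T + 2 ^ k0 + n2 <= t)%N by rewrite leq_divRL.
  have [|[k [i [k_gt0 iN Nk tE tk]]]|away] := hT t; first by lia.
    have k0k : (k0 <= k)%N.
      rewrite -ltnS -(ltn_exp2l _ _ (isT : 1 < 2)%N); lia.
    have := hk0 k i j k0k iN jl; rewrite -tE; have := Fx i j iN jl.
    by rewrite ltr_norml; lra.
  have := lambda_blocks R wP (marked N c g h P) t jl.
  have [_ /(_ away)] := hd (marked N c g h P t) j (seq_shift t.+1 (marked N c g h P))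
    (fun i => marked N c g h P (t - 1 - i)) jl.
  rewrite -/l -/M; have : 4^-1 ^+ t <= 4^-1 ^+ n2 :> R.
    by apply: ler_wiXn2l; [lra|lra|lia].
  by rewrite ler_norml; lra.
move=> n0; have [k0 hk0] := lambda_near_marker N c g h P e0.
pose k := (k0 + n0 + N)%N.
exists ((centre k - N + x.1) * l + x.2)%N.
  have : (k < 2 ^ k)%N by exact: ltn_expl.
  have : (centre k - N <= (centre k - N + x.1) * l + x.2)%N.
    by rewrite -[leqLHS]addn0 leq_add // (leq_trans _ (leq_pmulr _ _)) ?leq_addr.
  rewrite /centre /k; lia.
have k0k : (k0 <= k)%N by rewrite /k; lia.
have x1N : (x.1 <= N + N)%N by rewrite -ltnS; exact: ltn_ord.
have := hk0 k x.1 x.2 k0k x1N (ltn_ord _).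
by rewrite -/(F x) ltr_norml; lra.
Qed.

(** The upper limit [phi P], together with the position where it is attained,
    determines the set [P]; hence Cantor's diagonal argument applies. *)
Lemma uncountable_block_limsups :
  ~ countable [set v : R | exists b, is_limsup (lambda R (blocks w b)) v].
Proof.
have [N [c [g [h [phi [phiP /choice[I /choice[J IJ]]]]]]]] := marked_limsup.
set S := [set v | _] => /countable_injP[f finj].
pose F (P : set nat) := (f (phi P), I P, J P).
have Finj : injective F.
  move=> P P' [fE IE JE].
  have {}fE : phi P = phi P'.
    apply: finj => //; rewrite inE; first by exists (marked N c g h P).
    by exists (marked N c g h P').
  have [i1 j1 e1] := IJ P; have [i2 j2 e2] := IJ P'.
  apply: (marker_value_inj (c := c) (g := g) (h := h) i1 j1).
  by rewrite -e1 fE e2 IE JE.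
pose D := [set n : nat | exists P, pickle (F P) = n /\ ~ P n].
have nD : ~ D (pickle (F D)).
  move=> DD; have [P [/(pcan_inj pickleK)/Finj PE]] := DD.
  by rewrite PE; exact.
by apply: (nD); exists D.
Qed.

End MarkedLimsup.

(** * Recurrent words and loops *)

Section RecurrentFactors.
Implicit Types (d : nat -> nat) (u x y : seq nat).

(** The word [u] of length [K] occurs infinitely often in [d]. *)
Definition recurrent K d u := forall N, exists2 n, (N <= n)%N & factor d n K = u.

(** An eventual property holds uniformly over a finite set. *)
Lemma finite_uniform (T : eqType) (A : set T) (Q : T -> nat -> Prop) :
  finite_set A -> (forall a m n, (m <= n)%N -> Q a m -> Q a n) ->
  (forall a, A a -> exists n, Q a n) -> exists n, forall a, A a -> Q a n.
Proof.
move=> /finite_seqP[s ->] mono; elim: s => [|a s IH] ex; first by exists 0%N.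
have [u us|n hn] := IH; first by apply: ex; rewrite /= inE us orbT.
have [|m hm] := ex a; first by rewrite /= inE eqxx.
exists (maxn m n) => u; rewrite /= inE => /orP[/eqP ->|us].
  by apply: mono hm; exact: leq_maxl.
by apply: mono (hn u us); exact: leq_maxr.
Qed.

Section Bounded.
Variables (K M n1 : nat) (d : nat -> nat).
Hypothesis dM : forall n, (n1 <= n)%N -> (d n <= M)%N.

Lemma bounded_factor n : (n1 <= n)%N ->
  exists t : K.-tuple 'I_M.+1, map val t = factor d n K.
Proof.
move=> nn; exists [tuple inord (d (n + i)%N) | i < K] => //=.
rewrite -map_comp /factor /mkseq -val_enum_ord -map_comp.
by apply/eq_map => i /=; rewrite inordK // ltnS dM // (leq_trans nn) // leq_addr.
Qed.

Lemma bounded_recurrent u : recurrent K d u ->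
  exists t : K.-tuple 'I_M.+1, map val t = u.
Proof. by move=> /(_ n1)[n nn <-]; exact: bounded_factor. Qed.

Let words := (fun t : K.-tuple 'I_M.+1 => map val t) @` [set: K.-tuple 'I_M.+1].

Let words_finite : finite_set words.
Proof. exact/finite_image/finite_finset. Qed.

Lemma recurrent_finite : finite_set [set u | recurrent K d u].
Proof.
by apply: sub_finite_set words_finite => u /bounded_recurrent[t <-]; exists t.
Qed.

Lemma eventually_recurrent :
  exists n0, forall n, (n0 <= n)%N -> recurrent K d (factor d n K).
Proof.
have [|||n0 hn0] := @finite_uniform _ (words `&` [set u | ~ recurrent K d u])
  (fun u n0 => forall n, (n0 <= n)%N -> factor d n K <> u).
- by apply: sub_finite_set words_finite; exact: subIsetl.
- by move=> u m n mn h k nk; apply: h; exact: leq_trans nk.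
- move=> u [_ /= nr]; apply: contrapT => H; apply: nr => N.
  apply: contrapT => H2; apply: H; exists N => n Nn E; apply: H2; by exists n.
exists (n0 + n1)%N => n nn; apply: contrapT => nr.
apply: (hn0 (factor d n K) _ n) => //; last by lia.
by split=> //; have [|t <-] := @bounded_factor n; [lia|exists t].
Qed.

End Bounded.

(** A word that commutes with [u] is a prefix of the periodic word [u u u ...]. *)
Lemma commute_periodic x u : (0 < size u)%N -> x ++ u = u ++ x ->
  forall i, (i < size x)%N -> nth 0%N x i = nth 0%N u (i %% size u).
Proof.
move=> u0 xu; elim/ltn_ind => i IH ix.
have [iu|ui] := ltnP i (size u).
  rewrite modn_small //; have := congr1 (fun s => nth 0%N s i) xu.
  by rewrite !nth_cat ix iu.
have := congr1 (fun s => nth 0%N s i) xu.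
rewrite !nth_cat ix ltnNge ui /= => ->.
rewrite IH; [|lia|lia].
by rewrite -[in RHS](subnK ui) modnDr.
Qed.

Lemma take_cat_take (T : Type) K (a b : seq T) :
  take K (a ++ b) = take K (a ++ take K b).
Proof.
rewrite !take_cat; case: ifP => // _; by rewrite take_takel // leq_subr.
Qed.

(** From [s1] and [s2] on, all the windows of length [K] of [d1] and [d2] are
    recurrent in [d1]; both sequences have the window [v] there, and it also recurs
    in [d2]; [d1] has finitely many recurrent windows, and [d1] and [d2] have no
    common tail. *)
Section Loops.
Variables (K : nat) (d1 d2 : nat -> nat) (s1 s2 : nat).
Hypotheses (pd1 : forall n, (0 < d1 n)%N) (pd2 : forall n, (0 < d2 n)%N).
Let v := factor d1 s1 K.
Hypothesis rec1 : forall n, (s1 <= n)%N -> recurrent K d1 (factor d1 n K).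
Hypothesis rec2 : forall n, (s2 <= n)%N -> recurrent K d1 (factor d2 n K).
Hypothesis v2 : recurrent K d2 v.
Hypothesis s2v : factor d2 s2 K = v.
Hypothesis fin1 : finite_set [set u | recurrent K d1 u].
Hypothesis tails : ~ exists p p', forall i, d1 (p + i)%N = d2 (p' + i)%N.

(** A word that leads from an occurrence of [v] to another one while reading only
    recurrent windows. *)
Definition loop x := [/\ (K <= size x)%N, take K x = v, all_pos x &
  forall i, (i < size x)%N -> recurrent K d1 (take K (drop i (x ++ v)))].

Let size_v : size v = K. Proof. exact: size_factor. Qed.

Let take_factor (d : nat -> nat) n k m : (k <= m)%N ->
  take k (factor d n m) = factor d n k.
Proof. by move=> km; rewrite -(subnKC km) factorD take_size_cat ?size_factor. Qed.

Let drop_factor (d : nat -> nat) n k m : (k <= m)%N ->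
  drop k (factor d n m) = factor d (n + k) (m - k).
Proof. by move=> km; rewrite -{1}(subnKC km) factorD drop_size_cat ?size_factor. Qed.

Lemma loop_factor d s t : positive d -> (s + K <= t)%N ->
  factor d s K = v -> factor d t K = v ->
  (forall n, (s <= n)%N -> recurrent K d1 (factor d n K)) ->
  loop (factor d s (t - s)).
Proof.
move=> pd st sv tv recd; split; rewrite ?size_factor.
- lia.
- by rewrite take_factor //; lia.
- exact: factor_pos.
- move=> i ist; rewrite -tv -[in factor d t K](subnKC (_ : s <= t)%N); last lia.
  rewrite -factorD drop_factor; last lia.
  by rewrite take_factor; [apply: recd|]; lia.
Qed.

Lemma loop_cat x y : loop x -> loop y -> loop (x ++ y).
Proof.
move=> [xK xv xp xr] [yK yv yp yr]; split.
- by rewrite size_cat; lia.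
- by rewrite takel_cat.
- by rewrite all_cat xp.
- move=> i; rewrite size_cat -catA => ixy; have [ix|xi] := ltnP i (size x).
    rewrite drop_cat ix take_cat_take [take K (y ++ v)]takel_cat // yv.
    by have := xr i ix; rewrite drop_cat ix.
  by rewrite drop_cat ltnNge xi /=; apply: yr; lia.
Qed.

(** Some loop reads all the recurrent windows. *)
Lemma covering_loop : exists x, loop x /\ forall u, recurrent K d1 u ->
  exists2 i, (i < size x)%N & take K (drop i (x ++ v)) = u.
Proof.
have [||T hT] := @finite_uniform _ _
  (fun u T => exists n, (s1 <= n < T)%N /\ factor d1 n K = u) fin1.
- by move=> u m n mn [k [km E]]; exists k; split=> //; lia.
- move=> u /(_ s1)[n sn nu]; exists n.+1, n; split=> //; lia.
have [t tT tv] := rec1 (leqnn s1) (s1 + K + T).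
rewrite -/v in tv.
exists (factor d1 s1 (t - s1)); split; first by apply: loop_factor => //; lia.
move=> u /hT[n [/andP[sn nT] nu]]; exists (n - s1)%N; first by rewrite size_factor; lia.
rewrite -tv -{2}(subnKC (_ : s1 <= t)%N); last lia.
rewrite -factorD drop_factor; last lia.
by rewrite take_factor; [rewrite subnKC|lia].
Qed.

(** Otherwise [d1] and [d2] would both end with the periodic sequence of period
    [u], and have a common tail. *)
Lemma noncommuting_loop u : loop u -> (0 < size u)%N ->
  exists2 x, loop x & x ++ u != u ++ x.
Proof.
move=> lu u0; apply: contrapT => H.
have comm x : loop x -> x ++ u = u ++ x.
  by move=> lx; apply/eqP; apply: contrapT => /negP ne; apply: H; exists x.
have per d s : positive d -> factor d s K = v -> recurrent K d v ->
    (forall n, (s <= n)%N -> recurrent K d1 (factor d n K)) ->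
    forall i, d (s + i)%N = nth 0%N u (i %% size u).
  move=> pd sv vr recd i; have [t tt tv] := vr (s + K + i.+1)%N.
  have st : (s + K <= t)%N by lia.
  have := commute_periodic u0 (comm _ (loop_factor pd st sv tv recd)) (i := i).
  rewrite size_factor => <-; last by lia.
  by rewrite nth_mkseq //; lia.
apply: tails; exists s1, s2 => i.
by rewrite (per d1 s1) ?(per d2 s2) //; apply: rec1.
Qed.

(** The words [xuxu] and [uxux] are loops that read all the recurrent windows, for
    [u] a covering loop and [x] a loop that does not commute with it. *)
Lemma loop_block_code : (0 < K)%N -> exists w, [/\ block_code w,
  forall b, shadowed K d1 (blocks w b) & forall b, shadowed K (blocks w b) d1].
Proof.
move=> K0; have [u [lu cov]] := covering_loop.
have u0 : (0 < size u)%N by case: lu => uK *; apply: leq_trans uK.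
have [x lx xu] := noncommuting_loop lu u0.
pose w (c : bool) := if c then (x ++ u) ++ (x ++ u) else (u ++ x) ++ (u ++ x).
have lw c : loop (w c) by case: c; do !apply: loop_cat.
have wP : block_code w.
  split.
  - by case=> //=; rewrite !size_cat; lia.
  - by rewrite /= size_cat addnn odd_double.
  - by move=> c; case: (lw c).
  - rewrite /= eqseq_cat; first by rewrite negb_and xu.
    by rewrite !size_cat addnC.
have wcov c z : recurrent K d1 z ->
    exists2 i, (i < size (w c))%N & take K (drop i (w c ++ v)) = z.
  move=> /cov[i iu <-]; case: c.
    exists (size (x ++ u ++ x) + i)%N; first by rewrite !size_cat; lia.
    rewrite (_ : w true ++ v = (x ++ u ++ x) ++ (u ++ v)); last by rewrite /= !catA.
    by rewrite drop_cat ltnNge leq_addr /= addKn.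
  exists i; first by rewrite !size_cat; lia.
  rewrite (_ : w false ++ v = u ++ (x ++ u ++ x ++ v)); last by rewrite /= !catA.
  rewrite !drop_cat iu take_cat_take [in RHS]take_cat_take.
  case: lx => xK xv _ _.
  by rewrite [take K (x ++ _)]takel_cat // xv [take K v]take_oversize // size_v.
have sw c : size (w c) = size (w true) by case: wP => ->.
have win b t i : (i < size (w true))%N ->
    factor (blocks w b) (t * size (w true) + i) K = take K (drop i (w (b t) ++ v)).
  move=> il; have [wK wv _ _] := lw (b t.+1).
  have := factorD (blocks w b) (t * size (w true)) (size (w true)) (size (w true)).
  rewrite -mulSnr !factor_block // => E.
  have -> : take K (drop i (w (b t) ++ v)) = take K (drop i (w (b t) ++ w (b t.+1))).
    by rewrite !drop_cat sw il [in RHS]take_cat_take wv.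
  rewrite -E drop_factor; last lia.
  by rewrite take_factor //; rewrite sw in wK; lia.
have factor_eq (d d' : nat -> nat) n n' : factor d n K = factor d' n' K ->
    forall i, (i < K)%N -> d (n + i)%N = d' (n' + i)%N.
  by move=> /(congr1 (nth 0%N))/funeqP E i iK; have := E i; rewrite !nth_mkseq.
exists w; split=> // b N.
  exists s1 => n sn; have [i il iE] := wcov (b N) _ (rec1 sn).
  exists (N * size (w true) + i)%N.
    by rewrite (leq_trans (leq_pmulr N (block_size_gt0 wP))) ?leq_addr.
  by apply: factor_eq; rewrite win -?iE //; rewrite -(sw (b N)).
exists 0%N => n _; rewrite (divn_eq n (size (w true))).
have il : (n %% size (w true) < size (w true))%N.
  by rewrite ltn_mod; exact: block_size_gt0 wP.
have [wK wv _ wr] := lw (b (n %/ size (w true))%N).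
have [|n' Nn' E] := wr (n %% size (w true))%N _ N; first by rewrite sw.
by exists n' => //; apply: factor_eq; rewrite win.
Qed.

End Loops.

End RecurrentFactors.

(** * Limit points of the spectrum *)

Section Accumulation.
Variable R : realType.

Lemma infinite_collision (T : choiceType) (F : finType) (A : set T) (f : T -> F) :
  infinite_set A -> exists x y, [/\ A x, A y, x != y & f x = f y].
Proof.
move=> infA; apply: contrapT => H; apply: infA.
have finj : {in A &, injective f}.
  move=> x y; rewrite !inE => Ax Ay fxy; apply/eqP; apply: contrapT => /negP xy.
  by apply: H; exists x, y.
by rewrite -(eq_finite_set (inj_card_eq finj)); exact: finite_finset.
Qed.

(** An uncountable bounded set has limit points other than a given [x], because
    infinitely many of its points stay away from [x]. *)
Lemma uncountable_limit_point (E : set R) (x e : R) : 0 < e ->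
  (forall v, E v -> `|v - x| <= e) -> ~ countable E ->
  exists y, [/\ limit_point E y, y != x & `|y - x| < 2 * e].
Proof.
move=> e0 Ee nE; pose F n := [set v | E v /\ 4^-1 ^+ n < `|v - x|].
have [n infn] : exists n, infinite_set (F n).
  apply: contrapT => H; apply: nE.
  apply: (@sub_countable _ _ _ (\bigcup_n (F n `|` [set x]))); last first.
    apply: bigcup_countable => // n _; apply: finite_set_countable.
    rewrite finite_setU; split=> //; apply: contrapT => Hn.
    by apply: H; exists n.
  apply: subset_card_le => v Ev.
  have [->|vx] := eqVneq v x; first by exists 0%N => //; right.
  have /quarter_small[n nv] : 0 < `|v - x| by rewrite normr_gt0 subr_eq0.
  by exists n => //; left.
have [y yF] : limit_point (F n) !=set0.
  apply: infinite_bounded_limit_point_nonempty => //.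
  exists (`|x| + e); split; first exact: num_real.
  move=> m xm v [/Ee vx _] /=; apply: le_trans (ltW xm).
  have -> : v = x + (v - x) by ring.
  by rewrite (le_trans (ler_normD _ _)) // lerD2l.
have q0 : 0 < 4^-1 ^+ n :> R by rewrite exprn_gt0 // invr_gt0.
have near (r : R) : 0 < r ->
    exists v, [/\ E v, 4^-1 ^+ n < `|v - x| & `|y - v| < r].
  by move=> r0; have [v [_ [Ev vn] yv]] := yF _ (nbhsx_ballx y r r0); exists v.
exists y; split.
- by move=> U /yF[v [vy [Ev _] Uv]]; exists v.
- apply/eqP => yx; have [v [_ vn]] := near _ q0.
  by rewrite yx distrC => vx; have := lt_trans vn vx; rewrite ltxx.
- have [v [/Ee ve _ yv]] := near e e0.
  have -> : y - x = (y - v) + (v - x) by ring.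
  by apply: le_lt_trans (ler_normD _ _) _; lra.
Qed.

Lemma shadowed_leq K K' d d' : (K <= K')%N ->
  shadowed K' d d' -> shadowed K d d'.
Proof.
move=> KK' sdd' N; have [n0 hn0] := sdd' N; exists n0 => n /hn0[n' Nn' h].
by exists n' => // i iK; apply: h; exact: leq_trans KK'.
Qed.

Lemma limsup_bounded_digits d (v : R) M : (forall n, (0 < d n)%N) ->
  is_limsup (lambda R d) v -> v < M%:R ->
  exists n1, forall n, (n1 <= n)%N -> (d n <= M)%N.
Proof.
move=> pd [dv _]; rewrite -subr_gt0 => /dv[n1 hn1]; exists n1 => n /hn1.
rewrite subrKC => /(le_lt_trans (digit_le_lambda R n pd)).
by rewrite ltr_nat => /ltnW.
Qed.

(** A limit point of the spectrum is a limit of other limit points: two points of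
    the spectrum near [x] whose expansions have the same recurrent windows yield
    a block code whose upper limits are all near [x]. *)
Lemma lagrange_spectrum_nearby (x e : R) :
  limit_point (lagrange_spectrum R) x -> 0 < e ->
  exists y, [/\ limit_point (lagrange_spectrum R) y, y != x & `|y - x| < e].
Proof.
move=> /limit_point_infinite_setP xL e0.
have e40 : 0 < e / 4 by lra.
have [K0 hK0] := limsup_shadowed e40; pose K := K0.+1.
have hK d d' v v' : (forall n, (0 < d n)%N) -> (forall n, (0 < d' n)%N) ->
    is_limsup (lambda R d) v -> is_limsup (lambda R d') v' ->
    shadowed K d d' -> v <= v' + e / 4.
  move=> pd pd' dv dv' /(shadowed_leq (leqnSn _)); exact: hK0.
have := xL _ (nbhsx_ballx x _ e40); set S := _ `&` _ => infS.
have Sx y : S y -> `|x - y| < e / 4 by case.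
have [M xM] : exists M : nat, x + e < M%:R.
  by exists (Num.truncn (x + e)).+1; apply: real_truncnS_gt; exact: num_real.
have /choice[D DP] : forall y, exists d : nat -> nat,
    S y -> (forall n, (0 < d n)%N) /\ is_limsup (lambda R d) y.
  move=> y; have [Sy|nS] := pselect (S y); last by exists id.
  by case: (Sy) => _ /lagrange_spectrumP[d pd dy]; exists d.
have DM y : S y -> exists n1, forall n, (n1 <= n)%N -> (D y n <= M)%N.
  move=> Sy; have [pd dy] := DP y Sy; apply: (limsup_bounded_digits pd dy).
  by have := Sx y Sy; rewrite ltr_norml; lra.
(* Finitely many sets of words can occur as sets of recurrent windows. *)
pose W y := [set t : K.-tuple 'I_M.+1 | `[< recurrent K (D y) (map val t) >]]%SET.
have [y1 [y2 [S1 S2 y12 W12]]] := infinite_collision W infS.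
have [pd1 dy1] := DP _ S1; have [pd2 dy2] := DP _ S2.
have [m1 hm1] := DM _ S1; have [m2 hm2] := DM _ S2.
have rec12 u : recurrent K (D y1) u <-> recurrent K (D y2) u.
  have memW y t : (t \in W y) = `[< recurrent K (D y) (map val t) >] by rewrite inE.
  split=> ru.
    have [t tu] := bounded_recurrent hm1 ru.
    by apply/asboolP; rewrite -tu -memW -W12 memW tu; apply/asboolP.
  have [t tu] := bounded_recurrent hm2 ru.
  by apply/asboolP; rewrite -tu -memW W12 memW tu; apply/asboolP.
have [s1 hs1] := eventually_recurrent K hm1.
have [n2 hn2] := eventually_recurrent K hm2.
have v2 := (rec12 _).1 (hs1 _ (leqnn s1)).
have [s2 s2n s2v] := v2 n2.
have [w [wP w1 w2]] : exists w, [/\ block_code w,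
    forall b, shadowed K (D y1) (blocks w b) &
    forall b, shadowed K (blocks w b) (D y1)].
  apply: (@loop_block_code K (D y1) (D y2) s1 s2) => //.
  - by move=> n s2n'; apply/rec12/hn2; exact: leq_trans s2n'.
  - exact: recurrent_finite hm1.
  - move=> [p [p' pp']]; move/negP: y12; apply; apply/eqP/le_anti.
    rewrite (limsup_tail_le pd1 pd2 pp' dy1 dy2) /=.
    by apply: (limsup_tail_le (p := p') (p' := p) pd2 pd1 _ dy2 dy1).
pose E := [set v : R | exists b, is_limsup (lambda R (blocks w b)) v].
have EL : E `<=` lagrange_spectrum R.
  move=> v [b bv]; apply/lagrange_spectrumP; exists (blocks w b) => //.
  exact: blocks_pos.
have Ex v : E v -> `|v - x| <= e / 2.
  move=> [b bv]; have pb := blocks_pos wP b.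
  have := hK _ _ _ _ pd1 pb dy1 bv (w1 b); have := hK _ _ _ _ pb pd1 bv dy1 (w2 b).
  by have := Sx _ S1; rewrite ltr_norml ler_norml; lra.
have [||y [yE yx yxe]] := uncountable_limit_point (_ : 0 < e / 2) Ex; first lra.
  exact: uncountable_block_limsups.
exists y; split=> //; last by lra.
by move=> U /yE[v [vy /EL Lv Uv]]; exists v.
Qed.

End Accumulation.

Theorem theorem3 (R : realType) :
  perfect_set (limit_point (lagrange_spectrum R)).
Proof.
have cL : closed (limit_point (lagrange_spectrum R)).
  exact/limit_point_closed/hausdorff_accessible/Rhausdorff.
split=> //; apply/seteqP; split=> x.
  by move/subset_limit_point; rewrite -(closure_id _).1.
move=> xL U /nbhs_ballP[e /= e0 eU].
have [y [yL yx ye]] := lagrange_spectrum_nearby xL e0.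
by exists y; split=> //; apply: eU; rewrite /ball /= distrC.
Qed.
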